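(* Let $\mathbb S=(S,\sigma,v)$ be a generalised $d$-hypersurface. There exists an orthonormal basis $\{w_i\}_{i=1}^d$ of $\mathbb R^d$ such that for any $1$-uniform cover $(\sigma_1,\dots,\sigma_m)$ of $[d]=\{1,\dots,d\}$, with $d_i=|\sigma_i|$ and $E_i=\mathrm{span}\{w_j:j\in\sigma_i\}$, we have $$\prod_{j=1}^m|P_{E_j}(\Pi(\mathbb S))|\le\frac{(\sqrt d)^d}{\prod_{j=1}^m\sqrt{d_j!}}\,|\Pi(\mathbb S)|.$$
   Context: A generalised $d$-hypersurface is a triple $\mathbb S=(S,\sigma,v)$ where $(S,\sigma)$ is a $\sigma$-finite measure space and $v:S\to\mathbb R^d$ is measurable. $\Pi(\mathbb S)$ is the compact convex set with support function $h_{\Pi(\mathbb S)}(y)=\int_S|\langle y,v(x)\rangle|\,d\sigma(x)$ (assumed finite for all $y$, i.e. $\int_S|v|\,d\sigma<\infty$). A $1$-uniform cover of $[d]$ is a family of (non-empty) subsets such that every element of $[d]$ belongs to exactly one of them. $P_E$ is the orthogonal projection onto $E$ and $|\cdot|$ is volume in the appropriate dimension. *)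

(* Defs.v *)
From HB Require Import structures.
From mathcomp Require Import all_boot all_order all_algebra.
From mathcomp Require Import all_classical all_reals all_analysis.

Set Implicit Arguments.
Unset Strict Implicit.
Unset Printing Implicit Defensive.

Import Order.TTheory GRing.Theory Num.Theory.
Import numFieldNormedType.Exports.

Local Open Scope classical_set_scope.
Local Open Scope ring_scope.

Section Euclidean.
Context {R : realType}.

Definition dot {d : nat} (x y : 'rV[R]_d) : R := \sum_i x ord0 i * y ord0 i.

(* The norm `|x| of the library on row vectors is the sup norm. *)
Definition enorm {d : nat} (x : 'rV[R]_d) : R := Num.sqrt (dot x x).

Definition orthonormal_basis {d : nat} (w : 'I_d -> 'rV[R]_d) : Prop :=
  (forall i j, dot (w i) (w j) = (i == j)%:R) /\
  (\sum_i <<w i>> == (1%:M : 'M[R]_d))%MS.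

(* Linear subspaces of R^d are row spaces of matrices, as in mxalgebra.  The
   row space of orthomx idfun 1%:M E is the orthogonal complement of that of E
   for the standard inner product. *)
Definition ortho_proj {d : nat} (E : 'M[R]_d) (x : 'rV[R]_d) : 'rV[R]_d :=
  x *m proj_mx E (orthomx idfun (1%:M : 'M[R]_d) E).

End Euclidean.

Section Volume.
Context {R : realType}.

(* n-fold product of the Lebesgue measure of the line; the base case is the
   unit mass on the one-point space R^0. *)
Fixpoint lebesgue_tuple (n : nat) : set (n.-tuple R) -> \bar R :=
  match n return set (n.-tuple R) -> \bar R with
  | 0%N => fun A => \d_([tuple] : 0.-tuple R) A
  | n'.+1 => fun A =>
      ((@lebesgue_measure R) \x (@lebesgue_tuple n'))%E
        [set p : R * n'.-tuple R | A [tuple of p.1 :: p.2]]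
  end.

Definition volume {n : nat} (A : set 'rV[R]_n) : \bar R :=
  lebesgue_tuple [set t : n.-tuple R | A (\row_i tnth t i)].

(* Orthonormal bases of the subspace E, given by the rows of B. *)
Definition is_onb_of {d : nat} (E : 'M[R]_d) (B : 'M[R]_(\rank E, d)) : Prop :=
  B *m B^T = 1%:M /\ (B == E)%MS.

(* (\rank E)-dimensional volume of a subset A of E: E is identified with
   R^(\rank E) by taking coordinates in an orthonormal basis of E.  Two such
   bases differ by a linear isometry, so the choice does not matter. *)
Definition subspace_volume {d : nat} (E : 'M[R]_d) (A : set 'rV[R]_d) :
    \bar R :=
  volume [set x *m (xget 0 (@is_onb_of d E))^T | x in A].

End Volume.

Section Hypersurface.
Context {R : realType} {d : nat}.

Definition borel_measurable {disp : measure_display} {S : measurableType disp}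
    (v : S -> 'rV[R]_d) : Prop :=
  measurable_fun [set: S] (v : S -> g_sigma_algebraType (@open 'rV[R]_d)).

Definition support_function (K : set 'rV[R]_d) (y : 'rV[R]_d) : \bar R :=
  ereal_sup [set (dot y x)%:E | x in K].

(* K is the body Pi of (S, sigma, v).  K is non-empty as soon as the integrals
   are finite, since the supremum over the empty set is -oo. *)
Definition is_Pi {disp : measure_display} {S : measurableType disp}
    (sigma : {sigma_finite_measure set S -> \bar R}) (v : S -> 'rV[R]_d)
    (K : set 'rV[R]_d) : Prop :=
  [/\ compact K, convex_set K &
      forall y, support_function K y =
                (\int[sigma]_(x in [set: S]) (`|dot y (v x)|%:E))%E].

Definition one_uniform_cover {m : nat} (s : 'I_m -> {set 'I_d}) : Prop :=
  (forall j, s j != finset.set0) /\ (forall k, exists! j, k \in s j).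

Definition span_of (w : 'I_d -> 'rV[R]_d) (s : {set 'I_d}) : 'M[R]_d :=
  (\sum_(j in s) <<w j>>)%MS.

End Hypersurface.

(* Main.v *)
(** Minimising [\int |v T|] over the matrices with [\det T = 1] and rescaling gives
    an invertible [T] for which [q = v T] is isotropic (Lewis' position):
    [\int |q| = d] and [\int q_i q_j / |q| = delta_ij].  Let [A = T^-1] and let [w]
    be an orthonormal eigenbasis of [A^T A].  Averaging [q] over small cells of
    directions [q / |q|] traps the body between zonotopes, and the volume of a
    zonotope of dimension [k] is [2^k / k!] times the sum of [|det|] over all
    [k]-tuples of its generators.  Write the generators as [rho_c alpha_c] with
    [|alpha_c| <= 1].  By Hadamard and Cauchy-Binet, the sum is at least
    [d! \det (\sum_c rho_c alpha_c^T alpha_c)], which is close to [d!]; hence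
    [|Pi| >= 2^d |\det A|].  By Cauchy-Schwarz and Cauchy-Binet, the projection
    of the body onto [E] of dimension [k] has volume at most
    [2^k (sqrt d)^k / sqrt k!] times the square root of the determinant of the
    compression of [A^T A] to [E].  Since [w] diagonalises [A^T A], the product of
    these determinants over a cover is [(\det A)^2].  If instead [v] lies almost
    everywhere in a hyperplane, let [w] contain its normal: the projection onto
    the [E_j] that contains this normal is then negligible. *)
Require Import Defs.
From HB Require Import structures.
From mathcomp Require Import all_boot all_order all_algebra.
From mathcomp Require Import all_classical all_reals all_analysis.
From mathcomp Require Import fingroup perm measurable_realfun.
From mathcomp Require Import ring lra.

Set Implicit Arguments.
Unset Strict Implicit.
Unset Printing Implicit Defensive.

Import Order.TTheory GRing.Theory Num.Theory.
Import numFieldNormedType.Exports.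

Local Open Scope classical_set_scope.
Local Open Scope ring_scope.

(** * Sums of determinants over tuples of rows *)

Section DetSum.
Context {R : realType}.
Implicit Types n k : nat.

(** The body enters only through inclusions, obtained from support functions by separation: a
    zonotope inside it for the lower bound, a zonotope around its projection for the upper one. Both
    determinant bounds see the discretisation only through its Gram matrix, so the body stays fixed
    and the limit is taken in a continuous function of that matrix near the identity. The constant
    comes from Cauchy-Schwarz: the weights rho_c sum to \int |q| = d, so their k-fold products sum
    to d^k. With k! from Cauchy-Binet and (2^k / k!)^2 from the zonotope, the square root is 2^k
    sqrt(d^k / k!). The dimensions of a cover add up to d, and the resulting 2^d cancels against the
    lower bound. In a general orthonormal basis the diagonal blocks of A^T A have determinants whose
    product is at least (\det A)^2 (Fischer), which is the wrong direction here; an eigenbasis gives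
    equality. The degenerate case is separate because a minimiser exists only if \int |<v, y>| is
    positive for every y <> 0: this bounds the entries of T on a sublevel set. *)

Definition detsum n k (a : 'M[R]_(n, k)) : R :=
  \sum_(f : {ffun 'I_k -> 'I_n}) `|\det (rowsub f a)|.

Lemma detsum_ge0 n k (a : 'M[R]_(n, k)) : 0 <= detsum a.
Proof. by apply: sumr_ge0 => f _; exact: normr_ge0. Qed.

Lemma detsumM n k (a : 'M[R]_(n, k)) (M : 'M[R]_k) :
  detsum (a *m M) = `|\det M| * detsum a.
Proof.
rewrite /detsum mulr_sumr; apply: eq_bigr => f _.
by rewrite -mul_rowsub_mx det_mulmx normrM mulrC.
Qed.

Lemma detsum_dim0 n (a : 'M[R]_(n, 0)) : detsum a = 1.
Proof.
rewrite /detsum (eq_bigr (fun=> 1)) => [|f _]; last by rewrite det_mx00 normr1.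
by rewrite big_const iter_addr_0 card_ffun !card_ord expn0.
Qed.

Lemma detsum_count0 k (a : 'M[R]_(0, k.+1)) : detsum a = 0.
Proof. by rewrite /detsum big1 // => f; case: (f ord0). Qed.

(** Tuples that avoid the new row are reindexed along [lift ord0]. The inverse of this map needs a
    default index, so the cases without columns and without rows of [a] are treated apart. *)
Lemma detsum_never n k (a : 'M[R]_(n, k)) (b : 'rV[R]_k) :
  \sum_(f : {ffun 'I_k -> 'I_(1 + n)} | [forall i, f i != ord0])
    `|\det (rowsub f (col_mx b a))| = detsum a.
Proof.
case: k a b => [|k] a b.
  rewrite detsum_dim0 -(detsum_dim0 (col_mx b a)).
  by apply: eq_bigl => f; apply/forallP; case.
case: n a => [|n] a.
  rewrite detsum_count0 big_pred0 // => f.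
  by apply/negP => /forallP/(_ ord0); case: (f ord0) => [[]].
pose lft (g : {ffun 'I_k.+1 -> 'I_n.+1}) : {ffun 'I_k.+1 -> 'I_(1 + n.+1)} :=
  [ffun i => lift ord0 (g i)].
rewrite /detsum (reindex_onto lft
  (fun f => [ffun i => odflt ord0 (unlift ord0 (f i))])) => [|f /forallP f0]; last first.
  apply/ffunP => i; rewrite !ffunE; case: unliftP (f0 i) => [j ->|->] //=.
apply: eq_big => [g|g _].
  apply/andP; split.
    by apply/forallP => i; rewrite !ffunE.
  by apply/eqP/ffunP => i; rewrite !ffunE liftK.
congr (`|\det _|); apply/matrixP => i j.
rewrite !mxE ffunE; case: splitP => [x|x] /= e.
  by case: x e => [[]].
by congr (a _ _); apply/val_inj; case: e.
Qed.

Lemma detsum_col0 n k (a : 'M[R]_(n, k)) :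
  detsum (col_mx (0 : 'rV[R]_k) a) = detsum a.
Proof.
rewrite -(detsum_never a 0) [LHS](bigID (fun f : {ffun _} => [forall i, f i != ord0])) /=.
rewrite [X in _ + X]big1 ?addr0 // => f /forallPn[i /negPn/eqP fi0].
apply/eqP; rewrite normr_eq0; apply/eqP.
rewrite (expand_det_row _ i) big1 // => j _.
rewrite !mxE fi0; case: splitP => [x _|x /= //]; by rewrite mxE mul0r.
Qed.

(** The algebraic twin of the volume recursion for zonotopes. A tuple that uses the new row twice
    has determinant zero; one that uses it once, at any of the k + 1 positions, reduces by Laplace
    expansion to a minor without the first column. *)
Lemma detsum_delta n k (a : 'M[R]_(n, 1 + k)) :
  detsum (col_mx (delta_mx ord0 ord0 : 'rV_(1 + k)) a) =
  detsum a + k.+1%:R * detsum (rsubmx a).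
Proof.
set b : 'rV_(1 + k) := delta_mx _ _.
pose G (f : {ffun 'I_(1 + k) -> 'I_(1 + n)}) := `|\det (rowsub f (col_mx b a))|.
have rowb f i : f i = ord0 -> rowsub f (col_mx b a) i =1 b ord0.
  move=> fi0 j; rewrite !mxE fi0; case: splitP => [x _|x /= //].
  by rewrite (ord1 x) /b !mxE.
have single i : \sum_(f : {ffun 'I_(1 + k) -> 'I_(1 + n)} | f i == ord0) G f =
    detsum (rsubmx a).
  (* The sum also runs over tuples with a second occurrence of the new row. In the minor that
     occurrence has lost its first coordinate and is the zero row, whence the added zero row on the
     right. *)
  rewrite -detsum_col0 /detsum.
  rewrite (reindex_onto
    (fun g : {ffun 'I_k -> 'I_(1 + n)} =>
       [ffun j : 'I_(1 + k) => if unlift i j is Some j' then g j' else ord0])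
    (fun f => [ffun j => f (lift i j)])) => [|f /eqP fi0]; last first.
    apply/ffunP => j; rewrite !ffunE; case: unliftP => [j' ->|->//].
    by rewrite ffunE.
  apply: eq_big => [g|g _].
    rewrite ffunE unlift_none eqxx /=; apply/eqP/ffunP => j.
    by rewrite !ffunE liftK.
  set f := [ffun j => _].
  have fi0 : f i = ord0 by rewrite ffunE unlift_none.
  rewrite /G (expand_det_row _ i) (bigD1 ord0) //= [X in _ + X]big1 ?addr0; last first.
    move=> j j0; rewrite rowb // /b mxE eqxx /=.
    by rewrite (negPf j0) mul0r.
  rewrite rowb // /b mxE !eqxx mul1r /cofactor normrM normrX normrN1 expr1n mul1r.
  congr (`|\det _|); apply/matrixP => r c; rewrite !mxE /f ffunE liftK.
  case: splitP => [x _|x _].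
    by rewrite !mxE (ord1 x) /=.
  by rewrite !mxE; congr (a _ _); apply/val_inj.
rewrite -(detsum_never a b) /detsum -/(G _).
rewrite (eq_bigr G) // [in RHS](eq_bigr G) //.
have -> : k.+1%:R * detsum (rsubmx a) =
    \sum_i \sum_(f : {ffun 'I_(1 + k) -> 'I_(1 + n)} | f i == ord0) G f.
  under [RHS]eq_bigr do rewrite single.
  by rewrite sumr_const card_ord mulr_natl.
under [X in _ = _ + X]eq_bigr do rewrite big_mkcond.
rewrite exchange_big /= [X in _ = X + _]big_mkcond /= -big_split /=.
apply: eq_bigr => f _; case: ifPn => [/forallP f0|/forallPn[i /negPn/eqP fi0]].
  by rewrite big1 ?addr0 // => i _; rewrite (negPf (f0 i)).
rewrite add0r (bigD1 i) //= fi0 eqxx.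
have [->|Gf0] := eqVneq (G f) 0.
  by rewrite add0r big1 // => j _; case: ifP.
rewrite big1 ?addr0 // => j ji; case: ifP => // /eqP fj0.
case/negP: Gf0; rewrite normr_eq0; apply/eqP.
by apply: (determinant_alternate ji) => c; rewrite !rowb.
Qed.

(** The sum is over tuples instead of subsets, which accounts for k!. Expanding both determinants
    and exchanging sums leaves, for each permutation s, the sign of s times the determinant of the
    Gram matrix with rows permuted by s, that is \det M. *)
Lemma cauchy_binet n k (w : 'rV[R]_n) (a : 'M[R]_(n, k)) :
  \sum_(f : {ffun 'I_k -> 'I_n}) (\prod_i w ord0 (f i)) * \det (rowsub f a) ^+ 2 =
  k`!%:R * \det (a^T *m diag_mx w *m a).
Proof.
set M := _ *m a.
have ME i j : M i j = \sum_c w ord0 c * a c i * a c j.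
  rewrite /M mul_mx_diag mxE; apply: eq_bigr => c _; rewrite !mxE.
  by rewrite [a c i * _]mulrC.
clearbody M.
have sumdet (s : 'S_k) : \sum_(t : 'S_k) (-1) ^+ t * \prod_i M (s i) (t i) =
    (-1) ^+ s * \det M.
  rewrite -det_perm -det_mulmx -row_permE /determinant.
  by apply: eq_bigr => t _; congr (_ * _); apply: eq_bigr => i _; rewrite mxE.
transitivity (\sum_(s : 'S_k) ((-1) ^+ s : R) * \sum_(t : 'S_k) (-1) ^+ t * \prod_i M (s i) (t i)).
  under [RHS]eq_bigr => s _.
    under eq_bigr => t _.
      under eq_bigr do rewrite ME.
      rewrite bigA_distr_bigA mulr_sumr.
      over.
    rewrite exchange_big mulr_sumr.
    over.
  rewrite exchange_big; apply: eq_bigr => f _.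
  rewrite expr2 {1}/determinant mulr_suml mulr_sumr; apply: eq_bigr => s _.
  rewrite /determinant mulr_sumr !mulr_sumr; apply: eq_bigr => t _.
  rewrite !big_split /=.
  under [X in (-1) ^+ s * X * _]eq_bigr do rewrite mxE.
  under [X in (-1) ^+ t * X]eq_bigr do rewrite mxE.
  move: (\prod_i w _ _) (\prod_i a _ _) (\prod_i a _ _) ((-1) ^+ s : R) ((-1) ^+ t : R).
  by move=> p q r x y; ring.
under eq_bigr => s _ do rewrite sumdet mulrA -expr2 -exprM mulnC exprM sqrrN !expr1n mul1r.
by rewrite sumr_const mulr_natl card_Sn.
Qed.

(** The variance \sum_i p_i (x_i - t)^2 is non-negative at the weighted mean t = X / P; if P = 0,
    every weight vanishes. *)
Lemma weighted_cauchy_schwarz (I : finType) (p x : I -> R) :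
  (forall i, 0 <= p i) ->
  (\sum_i p i * x i) ^+ 2 <= (\sum_i p i) * \sum_i p i * x i ^+ 2.
Proof.
move=> p0; set P := \sum_i p i; set X := \sum_i _; set D := \sum_i _.
have key t : 0 <= D - t * X *+ 2 + t ^+ 2 * P.
  have -> : D - t * X *+ 2 + t ^+ 2 * P = \sum_i p i * (x i - t) ^+ 2.
    rewrite /D /X /P -mulrnAl !mulr_sumr -sumrB -big_split /=.
    by apply: eq_bigr => i _; ring.
  by apply: sumr_ge0 => i _; rewrite mulr_ge0 ?sqr_ge0.
have P0 : 0 <= P by exact: sumr_ge0.
have [Pz|Pn] := eqVneq P 0.
  have : X = 0.
    rewrite /X big1 // => i _.
    by rewrite (psumr_eq0P _ Pz) ?mul0r.
  by move=> ->; rewrite Pz mul0r expr0n.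
have Pp : 0 < P by rewrite lt_def Pn.
have := mulr_ge0 P0 (key (X / P)).
suff -> : P * (D - X / P * X *+ 2 + (X / P) ^+ 2 * P) = P * D - X ^+ 2 by rewrite subr_ge0.
by field.
Qed.

(** Cauchy-Schwarz over tuples f with weights \prod_i w_(f i), whose sum is (\sum_c w_c)^k, followed
    by Cauchy-Binet for the squares. *)
Lemma detsum_le n k (w : 'rV[R]_n) (a : 'M[R]_(n, k)) :
  (forall c, 0 <= w ord0 c) ->
  detsum (diag_mx w *m a) ^+ 2 <=
  (\sum_c w ord0 c) ^+ k * (k`!%:R * \det (a^T *m diag_mx w *m a)).
Proof.
move=> w0; rewrite -cauchy_binet.
have -> : (\sum_c w ord0 c) ^+ k =
    \sum_(f : {ffun 'I_k -> 'I_n}) \prod_i w ord0 (f i).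
  by rewrite -(bigA_distr_bigA (fun=> w ord0)) prodr_const card_ord.
have -> : detsum (diag_mx w *m a) =
    \sum_(f : {ffun 'I_k -> 'I_n}) (\prod_i w ord0 (f i)) * `|\det (rowsub f a)|.
  apply: eq_bigr => f _.
  have -> : rowsub f (diag_mx w *m a) = diag_mx (\row_i w ord0 (f i)) *m rowsub f a.
    by apply/matrixP => i j; rewrite !mul_diag_mx !mxE.
  rewrite det_mulmx normrM det_diag; congr (_ * _).
  rewrite ger0_norm; last by apply: prodr_ge0 => i _; rewrite mxE.
  by apply: eq_bigr => i _; rewrite mxE.
under [X in _ <= _ * X]eq_bigr do rewrite -[\det _ ^+ 2]real_normK ?num_real//.
by apply: weighted_cauchy_schwarz => f; exact: prodr_ge0.
Qed.
End DetSum.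

(** * Euclidean norm, Householder reflections and Hadamard's inequality *)

Section EuclideanAlgebra.
Context {R : realType}.

Lemma dotE d (x y : 'rV[R]_d) : dot x y = (x *m y^T) ord0 ord0.
Proof. by rewrite mxE; apply: eq_bigr => i _; rewrite mxE. Qed.

Lemma dotC d (x y : 'rV[R]_d) : dot x y = dot y x.
Proof. by apply: eq_bigr => i _; rewrite mulrC. Qed.

Lemma dotDl d (x y z : 'rV[R]_d) : dot (x + y) z = dot x z + dot y z.
Proof. by rewrite !dotE mulmxDl mxE. Qed.

Lemma dotZl d (c : R) (x y : 'rV[R]_d) : dot (c *: x) y = c * dot x y.
Proof. by rewrite !dotE -scalemxAl mxE. Qed.

Lemma dotNl d (x y : 'rV[R]_d) : dot (- x) y = - dot x y.
Proof. by rewrite -scaleN1r dotZl mulN1r. Qed.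

Lemma dotDr d (x y z : 'rV[R]_d) : dot x (y + z) = dot x y + dot x z.
Proof. by rewrite dotC dotDl !(dotC x). Qed.

Lemma dotZr d (c : R) (x y : 'rV[R]_d) : dot x (c *: y) = c * dot x y.
Proof. by rewrite dotC dotZl dotC. Qed.

Lemma dotNr d (x y : 'rV[R]_d) : dot x (- y) = - dot x y.
Proof. by rewrite dotC dotNl dotC. Qed.

Lemma dot0l d (y : 'rV[R]_d) : dot 0 y = 0.
Proof. by rewrite dotE mul0mx mxE. Qed.

Lemma dot_mulmx m d (x : 'rV[R]_m) (M : 'M[R]_(m, d)) (y : 'rV[R]_d) :
  dot (x *m M) y = dot x (y *m M^T).
Proof. by rewrite !dotE trmx_mul trmxK mulmxA. Qed.

Lemma dotxx_ge0 d (x : 'rV[R]_d) : 0 <= dot x x.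
Proof. by apply: sumr_ge0 => i _; rewrite -expr2 sqr_ge0. Qed.

Lemma dotxx_eq0 d (x : 'rV[R]_d) : (dot x x == 0) = (x == 0).
Proof.
apply/eqP/eqP => [x0|->]; last by rewrite dot0l.
apply/rowP => i; rewrite mxE; apply/eqP; rewrite -sqrf_eq0 expr2.
by apply/eqP/(psumr_eq0P _ x0) => // j _; rewrite -expr2 sqr_ge0.
Qed.

Lemma dotxx_gt0 d (x : 'rV[R]_d) : (0 < dot x x) = (x != 0).
Proof. by rewrite lt_def dotxx_ge0 dotxx_eq0 andbT. Qed.

Lemma enorm_ge0 d (x : 'rV[R]_d) : 0 <= enorm x.
Proof. exact: sqrtr_ge0. Qed.

Lemma enorm_sqr d (x : 'rV[R]_d) : enorm x ^+ 2 = dot x x.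
Proof. by rewrite sqr_sqrtr // dotxx_ge0. Qed.

Lemma enorm_eq0 d (x : 'rV[R]_d) : (enorm x == 0) = (x == 0).
Proof. by rewrite -dotxx_eq0 -enorm_sqr sqrf_eq0. Qed.

Lemma enormZ d (c : R) (x : 'rV[R]_d) : enorm (c *: x) = `|c| * enorm x.
Proof. by rewrite /enorm dotZl dotZr mulrA -expr2 sqrtrM ?sqr_ge0 // sqrtr_sqr. Qed.

Lemma dot_le_enorm d (x y : 'rV[R]_d) : `|dot x y| <= enorm x * enorm y.
Proof.
rewrite -(ler_pXn2r (n := 2)) ?nnegrE ?mulr_ge0 ?enorm_ge0 //.
rewrite exprMn !enorm_sqr real_normK ?num_real //.
have [->|x0] := eqVneq x 0; first by rewrite !dot0l mul0r expr0n.
have xp : 0 < dot x x by rewrite dotxx_gt0.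
set t := dot x y / dot x x.
rewrite -subr_ge0.
have -> : dot x x * dot y y - dot x y ^+ 2 = dot x x * dot (y - t *: x) (y - t *: x).
  rewrite !(dotDl, dotDr, dotNl, dotNr, dotZl, dotZr) (dotC y x) /t.
  by field; rewrite gt_eqF.
by rewrite mulr_ge0 ?dotxx_ge0.
Qed.

Lemma enormD d (x y : 'rV[R]_d) : enorm (x + y) <= enorm x + enorm y.
Proof.
rewrite -(ler_pXn2r (n := 2)) ?nnegrE ?addr_ge0 ?enorm_ge0 //.
rewrite sqrrD !enorm_sqr dotDl !dotDr (dotC y x).
have := le_trans (ler_norm _) (dot_le_enorm x y).
lra.
Qed.

Lemma coord_le_enorm d (x : 'rV[R]_d) i : `|x ord0 i| <= enorm x.
Proof.
rewrite -sqrtr_sqr ler_sqrt ?dotxx_ge0 // /dot (bigD1 i) //= -expr2 lerDl.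
by apply: sumr_ge0 => j _; rewrite -expr2 sqr_ge0.
Qed.

Lemma enorm_le_sum d (x : 'rV[R]_d) : enorm x <= \sum_i `|x ord0 i|.
Proof.
have -> : x = \sum_i x ord0 i *: delta_mx ord0 i by exact: row_sum_delta.
rewrite [leRHS](_ : _ = \sum_i enorm (x ord0 i *: (delta_mx ord0 i : 'rV_d))); last first.
  rewrite -row_sum_delta; apply: eq_bigr => i _; rewrite enormZ.
  rewrite [enorm _](_ : _ = 1) ?mulr1 // /enorm dotE trmx_delta mul_delta_mx mxE.
  by rewrite !eqxx sqrtr1.
elim/big_rec2 : _ => [|i b a _ le_ab]; first by rewrite /enorm dot0l sqrtr0.
by rewrite (le_trans (enormD _ _)) // lerD2l.
Qed.

Lemma enorm_orthogonal d (x : 'rV[R]_d) (Q : 'M[R]_d) :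
  Q *m Q^T = 1%:M -> enorm (x *m Q) = enorm x.
Proof. by move=> QQ; rewrite /enorm dot_mulmx -mulmxA QQ mulmx1. Qed.

Lemma norm_det_orthogonal d (Q : 'M[R]_d) : Q *m Q^T = 1%:M -> `|\det Q| = 1.
Proof.
move=> /(congr1 (@determinant _ _)); rewrite det_mulmx det_tr det1 -expr2.
by move=> /(congr1 Num.sqrt); rewrite sqrtr_sqr sqrtr1.
Qed.

(** [Q] is the reflection in the hyperplane orthogonal to u = y - |y| e_0. Since y and |y| e_0 have
    equal norms, <u, u> = 2 <y, u>, and the reflection exchanges them. *)
Lemma householder d (y : 'rV[R]_(1 + d)) :
  exists2 Q : 'M[R]_(1 + d), Q *m Q^T = 1%:M &
    y *m Q = enorm y *: delta_mx ord0 ord0.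
Proof.
set e : 'rV[R]_(1 + d) := delta_mx ord0 ord0.
set u := y - enorm y *: e.
have ee : dot e e = 1 by rewrite dotE trmx_delta mul_delta_mx mxE eqxx.
have [u0|u0] := eqVneq u 0.
  exists 1%:M; first by rewrite trmx1 mulmx1.
  by rewrite mulmx1; apply/eqP; rewrite -subr_eq0 -/u u0.
have up : dot u u != 0 by rewrite dotxx_eq0.
have yuE : dot u u = 2 * dot y u.
  rewrite /u !(dotDl, dotDr, dotNl, dotNr, dotZl, dotZr) ee (dotC e y) -enorm_sqr.
  by ring.
have yue : y - u = enorm y *: e by rewrite /u opprB addrCA subrr addr0.
clearbody u.
have uuM : u *m u^T = (dot u u)%:M by rewrite [LHS]mx11_scalar -dotE.
have yuM : y *m u^T = (dot y u)%:M by rewrite [LHS]mx11_scalar -dotE.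
pose P := (2 / dot u u) *: (u^T *m u).
have PT : P^T = P by rewrite /P linearZ /= trmx_mul trmxK.
have PP : P *m P = P + P.
  rewrite /P -scalemxAl -scalemxAr -mulmxA (mulmxA u) uuM mul_scalar_mx.
  rewrite -scalemxAr !scalerA -scalerDl; congr (_ *: _).
  by field.
exists (1%:M - P).
  rewrite linearB /= trmx1 PT mulmxBl mul1mx mulmxBr mulmx1 PP.
  by rewrite opprB addrK subrK.
rewrite mulmxBr mulmx1 /P -scalemxAr mulmxA yuM mul_scalar_mx scalerA.
have -> : 2 / dot u u * dot y u = 1.
  by rewrite yuE; field; move: up; rewrite yuE mulf_eq0 pnatr_eq0.
by rewrite scale1r.
Qed.

(** A reflection takes the first row to a multiple of e_0 and preserves row norms and |det|. The
    matrix is then block lower triangular, and the rows of its lower right block have only become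
    shorter. *)
Lemma hadamard_unit k (a : 'M[R]_k) :
  (forall i, enorm (row i a) <= 1) -> `|\det a| <= 1.
Proof.
elim: k a => [|k IH] a a1; first by rewrite det_mx00 normr1.
have [Q QQ yQ] := householder (row ord0 a).
have <- : `|\det (a *m Q)| = `|\det a|.
  by rewrite det_mulmx normrM (norm_det_orthogonal QQ) mulr1.
have aQ1 i : enorm (row i (a *m Q)) <= 1 by rewrite row_mul enorm_orthogonal.
have row0 j : (a *m Q) ord0 j = enorm (row ord0 a) * (j == ord0)%:R.
  have := congr1 (fun z : 'rV_(1 + k) => z ord0 j) yQ.
  by rewrite -row_mul !mxE => ->; rewrite eqxx.
pose b : 'M[R]_(1 + k) := a *m Q.
rewrite -/b; change (forall j, b ord0 j = enorm (row ord0 a) * (j == ord0)%:R) in row0.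
change (forall i, enorm (row i b) <= 1) in aQ1; clearbody b.
rewrite -[b]submxK.
have -> : ursubmx b = 0.
  apply/matrixP => i j; rewrite (ord1 i) !mxE.
  rewrite [lshift _ _](_ : _ = ord0); last exact/val_inj.
  by rewrite row0 mulr0.
rewrite [\det _](@det_lblock _ 1 k) normrM det_mx11 -[leRHS]mulr1 ler_pM //.
  rewrite !mxE [lshift _ _](_ : _ = ord0); last exact/val_inj.
  by rewrite row0 eqxx mulr1 ger0_norm ?enorm_ge0.
apply: IH => i; apply: le_trans (aQ1 (rshift 1 i)).
rewrite ler_sqrt ?dotxx_ge0 // /dot big_split_ord /= big_ord1.
rewrite [leLHS](eq_bigr (fun j => row (rshift 1 i) b ord0 (rshift 1 j) *
    row (rshift 1 i) b ord0 (rshift 1 j))); last by move=> j _; rewrite !mxE.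
by rewrite lerDr -expr2 sqr_ge0.
Qed.

(** By Hadamard each |det| is at most 1, hence det^2 <= |det| term by term in Cauchy-Binet. *)
Lemma detsum_ge n k (w : 'rV[R]_n) (a : 'M[R]_(n, k)) :
  (forall c, 0 <= w ord0 c) -> (forall c, enorm (row c a) <= 1) ->
  k`!%:R * \det (a^T *m diag_mx w *m a) <= detsum (diag_mx w *m a).
Proof.
move=> w0 a1; rewrite -cauchy_binet; apply: ler_sum => f _.
have -> : rowsub f (diag_mx w *m a) = diag_mx (\row_i w ord0 (f i)) *m rowsub f a.
  by apply/matrixP => i j; rewrite !mul_diag_mx !mxE.
rewrite det_mulmx normrM det_diag ger0_norm; last first.
  by apply: prodr_ge0 => i _; rewrite mxE.
under [X in _ <= X * _]eq_bigr do rewrite mxE.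
rewrite ler_wpM2l ?prodr_ge0 // -[_ ^+ 2]real_normK ?num_real // expr2.
rewrite ler_piMr //; apply: hadamard_unit => i.
suff -> : row i (rowsub f a) = row (f i) a by [].
by apply/rowP => j; rewrite !mxE.
Qed.
End EuclideanAlgebra.

(** * Volume and linear maps *)

Section TupleMeasure.
Context {R : realType}.

Definition tcons n (p : measurableTypeR R * n.-tuple (measurableTypeR R)) :
  n.+1.-tuple (measurableTypeR R) := [tuple of p.1 :: p.2].

Lemma measurable_tcons n : measurable_fun setT (@tcons n).
Proof. by apply: measurable_cons; [exact: measurable_fst|exact: measurable_snd]. Qed.

Definition tuncons n (t : n.+1.-tuple (measurableTypeR R)) :
  measurableTypeR R * n.-tuple (measurableTypeR R) :=
  (tnth t ord0, [tuple of behead t]).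

Lemma measurable_tuncons n : measurable_fun setT (@tuncons n).
Proof.
apply/measurable_fun_pairP; split; [exact: measurable_tnth|exact: measurable_behead].
Qed.

Lemma tconsK n : cancel (@tcons n) (@tuncons n).
Proof.
by move=> [x t]; congr (_, _); rewrite ?(tnth_nth x)//; exact/val_inj.
Qed.

Section cons_measure.
Variables (n : nat).
Variable m : {sigma_finite_measure set (n.-tuple (measurableTypeR R)) -> \bar R}.

(** The recursion step of [lebesgue_tuple], packaged as a sigma-finite measure so that Tonelli's
    theorem applies to [volume]. *)
Definition cons_measure (A : set (n.+1.-tuple (measurableTypeR R))) : \bar R :=
  (@lebesgue_measure R \x m)%E (@tcons n @^-1` A).

Let cons_measure0 : cons_measure set0 = 0%E.
Proof. by rewrite /cons_measure preimage_set0 measure0. Qed.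

Let cons_measure_ge0 A : (0 <= cons_measure A)%E.
Proof. exact: measure_ge0. Qed.

Let cons_measure_additive : semi_sigma_additive cons_measure.
Proof.
move=> F mF tF mUF; rewrite /cons_measure preimage_bigcup.
apply: measure_semi_sigma_additive.
- by move=> k; rewrite -[X in measurable X]setTI; exact: measurable_tcons.
- by apply/trivIsetP => i j _ _ ij; rewrite -preimage_setI
    (trivIsetP.1 tF)// preimage_set0.
- by rewrite -preimage_bigcup -[X in measurable X]setTI; exact: measurable_tcons.
Qed.

HB.instance Definition _ := isMeasure.Build _ _ _ cons_measure
  cons_measure0 cons_measure_ge0 cons_measure_additive.

Let cons_measure_sigma_finite : sigma_finite setT cons_measure.
Proof.
have /sigma_finiteP[F [TF incF finF]] := sigma_finiteT (@lebesgue_measure R).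
have /sigma_finiteP[G [TG incG finG]] := sigma_finiteT m.
exists (fun k => @tuncons n @^-1` (F k `*` G k)).
  apply/seteqP; split=> // t _.
  have [i _ Fi] : (\bigcup_k F k) (tuncons t).1 by rewrite -TF.
  have [j _ Gj] : (\bigcup_k G k) (tuncons t).2 by rewrite -TG.
  exists (maxn i j) => //; split.
    by move/subsetPset: (incF _ _ (leq_maxl i j)); apply.
  by move/subsetPset: (incG _ _ (leq_maxr i j)); apply.
move=> k; have [mF Fk] := finF k; have [mG Gk] := finG k; split.
  by rewrite -[X in measurable X]setTI; apply: measurable_tuncons => //; exact: measurableX.
rewrite /cons_measure -comp_preimage.
rewrite (_ : _ \o _ = id) ?preimage_id; last by apply/funext => p /=; exact: tconsK.
by rewrite product_measure1E// lte_mul_pinfty// ge0_fin_numE.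
Qed.

HB.instance Definition _ := @Measure_isSigmaFinite.Build _ _ _ cons_measure
  cons_measure_sigma_finite.
End cons_measure.

Fixpoint tuple_measure n :
    {sigma_finite_measure set (n.-tuple (measurableTypeR R)) -> \bar R} :=
  match n with
  | 0%N => \d_([tuple] : 0.-tuple (measurableTypeR R))
  | n'.+1 => cons_measure (tuple_measure n')
  end.

Lemma tuple_measureE n : tuple_measure n = @lebesgue_tuple R n :> (_ -> _).
Proof. by elim: n => [//|n IH]; rewrite /= -IH. Qed.

End TupleMeasure.

(** * Slicing and measurability in coordinates *)

Section Volume.
Context {R : realType}.
Local Notation mR := (measurableTypeR R).

Definition rowof n (t : n.-tuple mR) : 'rV[R]_n := \row_i tnth t i.

Definition rmeasurable n (A : set 'rV[R]_n) : Prop := measurable (@rowof n @^-1` A).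

Definition tup_of n (x : 'rV[R]_n) : n.-tuple mR := [tuple x ord0 i | i < n].

Lemma rowofK n : cancel (@tup_of n) (@rowof n).
Proof. by move=> x; apply/rowP => i; rewrite mxE tnth_mktuple. Qed.

Lemma volumeE n (A : set 'rV[R]_n) : volume A = tuple_measure n (@rowof n @^-1` A).
Proof. by rewrite tuple_measureE. Qed.

Lemma volume_ge0 n (A : set 'rV[R]_n) : (0 <= volume A)%E.
Proof. by rewrite volumeE. Qed.

Lemma rowof_tcons n (x : R) (t : n.-tuple R) :
  rowof (tcons (x, t)) = row_mx x%:M (rowof t) :> 'rV_(1 + n).
Proof.
apply/rowP => i; rewrite !mxE; case: splitP => j /= ij.
  by rewrite (ord1 j) in ij *; rewrite mxE eqxx mulr1n (tnth_nth 0) ij.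
by rewrite mxE !(tnth_nth 0) /= ij.
Qed.

(** Valid for every set, because the product measure is defined as the integral of the measures of
    the sections. Slicing in the other order, in [volume_rec_swap], goes through Tonelli. *)
Lemma volume_rec n (A : set 'rV[R]_(1 + n)) :
  volume A = (\int[lebesgue_measure]_x volume [set y | A (row_mx x%:M y)])%E.
Proof.
rewrite volumeE /= /cons_measure /product_measure1.
apply: eq_integral => x _ /=; rewrite volumeE; congr (tuple_measure n _).
by rewrite xsectionE; apply/seteqP; split=> t /=; rewrite rowof_tcons.
Qed.

Lemma rmeasurable_tcons n (A : set 'rV[R]_(1 + n)) : rmeasurable A ->
  measurable [set p : mR * n.-tuple mR | A (row_mx p.1%:M (rowof p.2))].
Proof.
move=> mA; have := @measurable_tcons R n measurableT _ mA; rewrite setTI.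
congr (measurable _); apply/seteqP.
by split=> -[x t] /=; rewrite -?rowof_tcons.
Qed.

Lemma rmeasurable_section n (A : set 'rV[R]_(1 + n)) (x : R) : rmeasurable A ->
  rmeasurable [set y | A (row_mx x%:M y)].
Proof.
move=> /rmeasurable_tcons/(measurable_xsection x); congr (measurable _).
by rewrite xsectionE.
Qed.

Lemma measurable_volume_section n (A : set 'rV[R]_(1 + n)) : rmeasurable A ->
  measurable_fun [set: mR] ((fun x => volume [set y | A (row_mx x%:M y)]) : mR -> \bar R).
Proof.
move=> /rmeasurable_tcons mA.
apply: eq_measurable_fun (measurable_fun_xsection (tuple_measure n) mA) => x _ /=.
rewrite volumeE; congr (tuple_measure n _).
by rewrite xsectionE.
Qed.

Lemma volume_rec_swap n (A : set 'rV[R]_(1 + n)) : rmeasurable A ->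
  volume A = (\int[tuple_measure n]_t
    lebesgue_measure [set x : mR | A (row_mx x%:M (rowof t))])%E.
Proof.
move=> /rmeasurable_tcons mA; rewrite volume_rec.
have := indic_fubini_tonelli (@lebesgue_measure R) (tuple_measure n) mA.
rewrite (indic_fubini_tonelli_FE (tuple_measure n) _) //.
rewrite (indic_fubini_tonelli_GE lebesgue_measure _) // => tonelli.
transitivity (\int[lebesgue_measure]_x
   (tuple_measure n \o xsection [set p : mR * n.-tuple mR | A (row_mx p.1%:M (rowof p.2))]) x)%E.
  apply: eq_integral => x _ /=; rewrite volumeE; congr (tuple_measure n _).
  by rewrite xsectionE.
rewrite tonelli; apply: eq_integral => t _ /=; congr lebesgue_measure.
by rewrite ysectionE.
Qed.

Lemma measurable_leb_section n (A : set 'rV[R]_(1 + n)) : rmeasurable A ->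
  measurable_fun setT ((fun t =>
    lebesgue_measure [set x : mR | A (row_mx x%:M (rowof t))]) : n.-tuple mR -> \bar R).
Proof.
move=> /rmeasurable_tcons mA.
apply: eq_measurable_fun (measurable_fun_ysection lebesgue_measure mA) => t _ /=.
congr lebesgue_measure.
by rewrite ysectionE.
Qed.

Lemma le_volume n (A B : set 'rV[R]_n) : rmeasurable A -> rmeasurable B ->
  A `<=` B -> (volume A <= volume B)%E.
Proof. move=> mA mB AB; rewrite !volumeE; apply: le_measure => [||t /AB//]; exact/mem_set. Qed.

Lemma rmeasurable_affine n m (A : set 'rV[R]_m) (M : 'M[R]_(n, m)) (c : 'rV[R]_m) :
  rmeasurable A -> rmeasurable [set x | A (x *m M + c)].
Proof.
move=> mA; pose f (t : n.-tuple mR) := tup_of (rowof t *m M + c).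
have mf : measurable_fun setT f.
  apply/measurable_fun_tnthP => j.
  rewrite (_ : _ \o f = fun t => (\sum_i (tnth t i : R) * M i j) + c ord0 j); last first.
    apply/funext => t /=; rewrite tnth_mktuple !mxE; congr (_ + _).
    by apply: eq_bigr => i _; rewrite mxE.
  apply: measurable_funD => //; apply: measurable_sum => i.
  by apply: measurable_funM => //; exact: measurable_tnth.
have := mf measurableT _ mA; rewrite setTI; congr (measurable _).
by apply/seteqP; split=> t; rewrite /f /= rowofK.
Qed.

(** The complement is a countable union of sup-norm balls with rational centre and radius 1 / (j +
    1), enumerated by [unpickle]; such a ball is a product of intervals. *)
Lemma rmeasurable_closed n (A : set 'rV[R]_n) : closed A -> rmeasurable A.
Proof.
move=> clA; have oA : open (~` A) by exact: closed_openC.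
rewrite /rmeasurable -[X in measurable X]setCK; apply: measurableC.
rewrite preimage_setC; set O := ~` A in oA *.
pose c (q : 'rV[rat]_n) : 'rV[R]_n := \row_i ratr (q ord0 i).
pose box (p : 'rV[rat]_n * nat) : set (n.-tuple mR) :=
  if pselect (ball (c p.1) (p.2.+1%:R^-1 : R) `<=` O)
  then @rowof n @^-1` ball (c p.1) (p.2.+1%:R^-1) else set0.
rewrite (_ : _ @^-1` O = \bigcup_k
    (if unpickle k is Some p then box p else set0)).
  apply: bigcupT_measurable => k; case: (unpickle k) => // -[q j].
  rewrite /box; case: pselect => [ok|?] /=; last exact: measurable0.
  rewrite (_ : _ @^-1` _ = \bigcap_(i in [set: 'I_n])
      ((@tnth n mR ^~ i) @^-1` ball (c q ord0 i) (j.+1%:R^-1 : R))).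
    apply: fin_bigcap_measurable => // i _; rewrite -[X in measurable X]setTI.
    apply: measurable_tnth => //.
    by apply: open_measurable; apply: ball_open; rewrite invr_gt0.
  apply/seteqP; split=> t /=.
    by move=> [_ hij] i _; have := hij ord0 i; rewrite [X in ball _ _ X]mxE.
  move=> hi; split=> [|i0 i]; first by rewrite invr_gt0.
  by rewrite (ord1 i0) [X in ball _ _ X]mxE; exact: hi.
apply/seteqP; split=> t /=; last first.
  move=> [k _]; case: (unpickle k) => // -[q j]; rewrite /box /=.
  by case: pselect => // sub /sub.
move=> Ot; have /nbhs_ballP[e /= e0 sub] : nbhs (rowof t) O by exact: open_nbhs_nbhs.
(* Half of [e], since the triangle inequality uses this radius twice: from the point to the rational
   centre, and from the centre to the rest of its ball. *)
have [j je] : exists j, j.+1%:R^-1 < e / 2 :> R.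
  have /ltr_add_invr[j] : 0 < e / 2 by rewrite divr_gt0.
  by rewrite add0r => je; exists j.
have j0 : 0 < j.+1%:R^-1 :> R by rewrite invr_gt0.
have /choice[q qP] : forall i, exists q : rat, ball (ratr q : R) (j.+1%:R^-1) (tnth t i : R).
  move=> i; move: (j.+1%:R^-1 : R) (tnth t i : R) j0 => r x r0.
  have : x - r < x by rewrite ltrBlDr ltrDl.
  move=> /rat_in_itvoo[q]; rewrite in_itv /= => /andP[lo hi]; exists q.
  by rewrite -ball_normE /= ltr_norml; apply/andP; split; lra.
pose qv : 'rV[rat]_n := \row_i q i.
exists (pickle (qv, j)) => //=; rewrite pickleK /box /=.
have cq i : c qv ord0 i = ratr (q i) by rewrite !mxE.
case: pselect => [ok|[]] /=.
  by split=> // i0 i; rewrite (ord1 i0) cq [X in ball _ _ X]mxE.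
move=> y [_ yq]; apply: sub; split=> // i0 i.
rewrite [e]splitr; apply: (@ball_triangle _ _ (c qv i0 i)); last first.
  by apply: le_ball (yq i0 i); exact: ltW.
rewrite (ord1 i0) cq [X in ball X]mxE; apply: ball_sym; apply: le_ball (qP i).
exact: ltW.
Qed.
End Volume.

(** * Change of variables for invertible linear maps *)

Section LinearChange.
Context {R : realType}.
Local Notation mR := (measurableTypeR R).
Local Notation leb := (@lebesgue_measure R).

Definition affine (a b : R) : mR -> mR := fun x => a * x + b.

Lemma measurable_affine (a b : R) : measurable_fun [set: mR] (affine a b).
Proof. by apply: measurable_funD => //; exact: measurable_funM. Qed.

Lemma affine_pushforward (a b : R) : exists m : {measure set mR -> \bar R},
  m = pushforward leb (affine a b) :> (_ -> _).
Proof.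
by unshelve eexists (pushforward leb (affine a b)); [exact: measurable_affine|].
Qed.

(** By uniqueness of the Lebesgue measure it is enough to compare the two sides on half-open
    intervals. *)
Lemma lebesgue_affine_pos (a b : R) (A : set mR) : 0 < a -> measurable A ->
  leb A = (a%:E * leb (affine a b @^-1` A))%E.
Proof.
move=> a0 mA; have [m mE] := affine_pushforward a b.
rewrite -[leb (_ @^-1` _)]/(pushforward leb (affine a b) A) -mE.
rewrite (@lebesgue_measure_unique R (mscale (NngNum (ltW a0)) m)) // => _ [[l u] _ <-].
rewrite /= [RHS](_ : _ = (a%:E * m [set` `]l, u]])%E) // mE /pushforward.
have -> : affine a b @^-1` [set` `]l, u]] = [set` `](l - b) / a, (u - b) / a]].
  apply/seteqP; split=> x /=; rewrite /affine !in_itv /= ltr_pdivrMr // ler_pdivlMr //;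
  by rewrite ltrBlDr lerBrDr mulrC.
rewrite !lebesgue_measure_itv /= !lte_fin ltr_pM2r ?invr_gt0 // ltrD2r.
case: ifP => _; last by rewrite mule0.
rewrite -!EFinB -EFinM; congr _%:E.
by field; rewrite gt_eqF.
Qed.

Lemma lebesgue_affine (a b : R) (A : set mR) : a != 0 -> measurable A ->
  leb A = (`|a|%:E * leb (affine a b @^-1` A))%E.
Proof.
move=> a0 mA; have [a_gt0|a_lt0|a_eq0] := ltgtP 0 a.
- by rewrite gtr0_norm //; exact: lebesgue_affine_pos.
- rewrite ltr0_norm // [LHS](@lebesgue_affine_pos (- a) b) ?oppr_gt0 //.
  congr (_ * _)%E; rewrite -lebesgue_measureN; last first.
    by rewrite -[X in measurable X]setTI; exact: measurable_affine.
  rewrite /pushforward; congr (leb _); apply/seteqP.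
  by split=> x /=; rewrite /affine mulrNN.
- by rewrite -a_eq0 eqxx in a0.
Qed.

Lemma integral_affine (a b : R) (f : mR -> \bar R) : a != 0 ->
  measurable_fun setT f -> (forall x, 0 <= f x)%E ->
  (\int[leb]_x f x = `|a|%:E * \int[leb]_x f (affine a b x))%E.
Proof.
move=> a0 mf f0; have [m mE] := affine_pushforward a b.
rewrite (eq_measure_integral (mscale (NngNum (normr_ge0 a)) m)); last first.
  move=> A mA _; rewrite [LHS](lebesgue_affine b a0) //.
  by rewrite [RHS](_ : _ = (`|a|%:E * m A)%E) // mE.
rewrite ge0_integral_mscale //; congr (_ * _)%E.
rewrite mE ge0_integral_pushforward ?preimage_setT //; exact: measurable_affine.
Qed.

Lemma rmeasurable_leb_section n (A : set 'rV[R]_(1 + n)) (y : 'rV[R]_n) :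
  rmeasurable A -> measurable [set x : mR | A (row_mx x%:M y)].
Proof.
move=> /rmeasurable_tcons/(measurable_ysection (tup_of y)); rewrite ysectionE.
by congr measurable; apply/seteqP; split=> x /=; rewrite rowofK.
Qed.

Lemma volume_translate n (A : set 'rV[R]_n) (c : 'rV[R]_n) : rmeasurable A ->
  volume [set x | A (x + c)] = volume A.
Proof.
elim: n A c => [|n IH] A c mA.
  congr volume; apply/seteqP; split=> x /=; by rewrite [x + c]thinmx0 [x]thinmx0.
rewrite [RHS]volume_rec (@integral_affine 1 (c ord0 ord0)) ?oner_eq0 //; last 2 first.
- exact: measurable_volume_section.
- by move=> x; exact: volume_ge0.
rewrite normr1 mul1e volume_rec; apply: eq_integral => x _.
rewrite /affine mul1r.
set A' := [set y | A (row_mx (x + c ord0 ord0)%:M y)].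
rewrite -(IH A' (rsubmx (c : 'rV_(1 + n)))); last exact: rmeasurable_section.
congr volume; apply/seteqP.
suff E (y : 'rV_n) : row_mx x%:M y + (c : 'rV_(1 + n)) =
    row_mx (x + c ord0 ord0)%:M (y + rsubmx (c : 'rV_(1 + n))).
  by split=> y; rewrite /A' /= -E.
rewrite -[in LHS](hsubmxK (c : 'rV_(1 + n))) add_row_mx; congr row_mx.
rewrite raddfD /=; congr (_ + _); apply/matrixP => i j; rewrite !ord1 !mxE eqxx mulr1n.
by congr (c _ _); exact/val_inj.
Qed.

(* Gaussian elimination on the first row and column: shears reduce to Fubini and
   translation invariance, and a shear makes the pivot nonzero if necessary. *)
Lemma volume_linear n (A : set 'rV[R]_n) (M : 'M[R]_n) : M \in unitmx ->
  rmeasurable A -> volume A = (`|\det M|%:E * volume [set x | A (x *m M)])%E.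
Proof.
elim: n A M => [|n IH] A M.
  move=> _ _; rewrite det_mx00 normr1 mul1e; congr volume; apply/seteqP.
  by split=> x /=; rewrite [x *m M]thinmx0 [x]thinmx0.
pose P (M : 'M[R]_(1 + n)) := forall A, rmeasurable A ->
  volume A = (`|\det M|%:E * volume [set x | A (x *m M)])%E.
have mlin (M' : 'M[R]_(1 + n)) B : rmeasurable B -> rmeasurable [set x | B (x *m M')].
  move=> /(@rmeasurable_affine _ _ _ _ M' 0); congr rmeasurable.
  by apply/seteqP; split=> x /=; rewrite addr0.
have PM (M1 M2 : 'M[R]_(1 + n)) : P M1 -> P M2 -> P (M1 *m M2).
  move=> P1 P2 B mB; rewrite det_mulmx mulrC normrM EFinM -muleA (P2 _ mB).
  rewrite (P1 _ (mlin M2 _ mB)); congr (_ * (_ * volume _))%E.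
  by apply/seteqP; split=> x /=; rewrite mulmxA.
have Pupper (c : 'rV[R]_n) : P (block_mx 1%:M c 0 1%:M).
  move=> B mB; rewrite det_ublock !det1 mulr1 normr1 mul1e !volume_rec.
  apply: eq_integral => x _ /=.
  rewrite -(volume_translate (x *: c) (rmeasurable_section x mB)).
  congr volume; apply/seteqP; split=> y /=;
  by rewrite mul_row_block mulmx1 !mulmx1 mulmx0 addr0 mul_scalar_mx addrC.
have Plower (c : 'cV[R]_n) : P (block_mx 1%:M 0 c 1%:M).
  move=> B mB; rewrite det_lblock !det1 mulr1 normr1 mul1e !volume_rec_swap //; last exact: mlin.
  apply: eq_integral => t _ /=; set y := rowof t.
  rewrite (@lebesgue_affine 1 ((y *m c) ord0 ord0)) ?oner_eq0 //; last first.
    exact: rmeasurable_leb_section.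
  rewrite normr1 mul1e; congr (leb _); apply/seteqP.
  suff E x : row_mx x%:M y *m block_mx 1%:M 0 c 1%:M =
      row_mx (1 * x + (y *m c) ord0 ord0)%:M y.
    by split=> x /=; rewrite E.
  rewrite mul_row_block !mulmx1 mulmx0 add0r mul1r raddfD /=; congr (row_mx (_ + _) _).
  exact: mx11_scalar.
have Pdown (D : 'M[R]_n) : D \in unitmx -> P (block_mx 1%:M 0 0 D).
  move=> uD B mB; rewrite det_ublock det1 mul1r !volume_rec.
  rewrite -ge0_integralZl_EFin //; last 2 first.
  - by move=> x _; exact: volume_ge0.
  - by apply: measurable_volume_section; exact: mlin.
  apply: eq_integral => x _; rewrite (IH _ D uD (rmeasurable_section x mB)).
  congr (_ * volume _)%E; apply/seteqP.
  by split=> y /=; rewrite mul_row_block mulmx1 !mulmx0 addr0 add0r.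
have Pscale (a : R) : a != 0 -> P (block_mx a%:M 0 0 1%:M).
  move=> a0 B mB; rewrite det_ublock det1 mulr1 det_mx11 mxE mulr1n !volume_rec.
  rewrite (@integral_affine a 0) //; last 2 first.
  - exact: measurable_volume_section.
  - by move=> x; exact: volume_ge0.
  congr (_ * _)%E; apply: eq_integral => x _; congr volume; apply/seteqP.
  split=> y /=; rewrite mul_row_block mulmx1 !mulmx0 addr0 add0r;
  by rewrite -scalar_mxM mulrC /affine addr0.
have Ppivot (M' : 'M[R]_(1 + n)) : M' ord0 ord0 != 0 -> M' \in unitmx -> P M'.
  move=> a0 uM; set a := M' ord0 ord0 in a0.
  pose b := ursubmx M'; pose c := dlsubmx M'; pose D := drsubmx M'.
  have ME : M' = block_mx a%:M b c D.
    rewrite -[LHS]submxK; congr block_mx.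
    by rewrite [LHS]mx11_scalar; congr _%:M; rewrite !mxE; congr (M' _ _); exact/val_inj.
  (* The Schur complement of the pivot; \det M' = a \det C, so it is invertible. *)
  pose C := D - a^-1 *: (c *m b).
  have dec : M' = block_mx 1%:M 0 (a^-1 *: c) 1%:M *m
      (block_mx a%:M 0 0 1%:M *m block_mx 1%:M 0 0 C) *m block_mx 1%:M (a^-1 *: b) 0 1%:M.
    rewrite !mulmx_block !(mul0mx, mulmx0, mul1mx, mulmx1, addr0, add0r) ME.
    rewrite mul_scalar_mx scalerA divff // scale1r.
    rewrite mul_mx_scalar scalerA divff // scale1r.
    by rewrite -scalemxAr /C addrC subrK.
  have uC : C \in unitmx.
    move: uM; rewrite !unitmxE dec !(det_mulmx, det_lblock, det_ublock, det1, mul1r, mulr1).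
    by rewrite unitrM => /andP[].
  rewrite dec; apply: (PM _ _ _ (Pupper _)); apply: (PM _ _ (Plower _)).
  by apply: PM; [exact: Pscale|exact: Pdown].
move=> uM; have [a0|a0] := eqVneq (M ord0 ord0) 0; last exact: Ppivot.
have [i ci] : exists i, dlsubmx (M : 'M[R]_(1 + n)) i ord0 != 0.
  apply/existsP; apply: contraLR uM => /existsPn c0.
  rewrite unitmxE (expand_det_col _ ord0) big1 ?unitr0 // => j _.
  have [->|] := eqVneq j ord0; first by rewrite a0 mul0r.
  case: (unliftP ord0 j) => [j' ->|->]; last by rewrite eqxx.
  have := c0 j'; rewrite negbK !mxE => /eqP cj _.
  suff -> : M (lift ord0 j') ord0 = 0 by rewrite mul0r.
  by rewrite -[RHS]cj; congr (M _ _); exact/val_inj.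
pose U (s : R) := block_mx 1%:M (s *: delta_mx ord0 i) 0 1%:M : 'M[R]_(1 + n).
have UU : U (-1) *m U 1 = 1%:M.
  rewrite mulmx_block !(mul0mx, mulmx0, mul1mx, mulmx1, addr0, add0r).
  by rewrite scale1r scaleN1r subrr -scalar_mx_block.
rewrite -[M]mul1mx -UU -mulmxA; apply: (PM _ _ (Pupper _)).
apply: Ppivot; last by rewrite unitmx_mul uM andbT unitmxE det_ublock !det1 mulr1 unitr1.
have ulE (N : 'M[R]_(1 + n)) : ulsubmx N ord0 ord0 = N ord0 ord0.
  by rewrite !mxE; congr (N _ _); exact/val_inj.
have E (N : 'M[R]_(1 + n)) : ulsubmx (U 1 *m N) = ulsubmx N + delta_mx ord0 i *m dlsubmx N.
  by rewrite -{1}[N]submxK mulmx_block block_mxKul mul1mx scale1r.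
rewrite -(ulE (U 1 *m M)) E -rowE mxE ulE a0 add0r mxE; exact: ci.
Qed.
End LinearChange.

(** * Continuity and closedness in spaces of matrices *)

Section MatrixTopology.
Context {R : realType}.

Lemma continuous_sumr (T : topologicalType) (I : Type) (r : seq I) (f : I -> T -> R) :
  (forall i, continuous (f i)) -> continuous (fun x => \sum_(i <- r) f i x).
Proof.
by move=> cf; apply: continuous_big => //; exact: add_continuous.
Qed.

Lemma continuous_prodr (T : topologicalType) (I : Type) (r : seq I) (f : I -> T -> R) :
  (forall i, continuous (f i)) -> continuous (fun x => \prod_(i <- r) f i x).
Proof.
by move=> cf; apply: continuous_big => //; exact: mul_continuous.
Qed.

Lemma continuous_mul2 (T : topologicalType) (f g : T -> R) :
  continuous f -> continuous g -> continuous (fun x => f x * g x).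
Proof. by move=> cf cg x; exact: (cvgM (cf x) (cg x)). Qed.

Lemma continuous_coords (T : topologicalType) m n (f : T -> 'M[R]_(m, n)) :
  (forall i j, continuous (fun x => f x i j)) -> continuous f.
Proof.
move=> cf x; apply/cvgrPdist_le => /= e e0; near=> y.
rewrite /Num.Def.normr /= mx_normrE (bigmax_le _ (ltW e0)) //= => i _.
rewrite !mxE /=; move: i; near: y; apply: filter_forall => /= i.
exact: ((cvgrPdist_le _ _).1 (cf i.1 i.2 x)).
Unshelve. all: by end_near. Qed.

Lemma continuous_entry m n (i : 'I_m) (j : 'I_n) :
  continuous (fun M : 'M[R]_(m, n) => M i j).
Proof. exact: coord_continuous. Qed.

Lemma continuous_mulmxr m n p (a : 'M[R]_(n, p)) :
  continuous (fun x : 'M[R]_(m, n) => x *m a).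
Proof.
apply: continuous_coords => i j.
rewrite (_ : (fun x => _) = (fun x : 'M[R]_(m, n) => \sum_k x i k * a k j)).
  apply: continuous_sumr => k; apply: continuous_mul2; first exact: continuous_entry.
  exact: cst_continuous.
by apply/funext => x; rewrite mxE.
Qed.

Lemma continuous_det n : continuous (fun M : 'M[R]_n => \det M).
Proof.
apply: continuous_sumr => s; apply: continuous_mul2; first exact: cst_continuous.
by apply: continuous_prodr => i; exact: continuous_entry.
Qed.

Lemma continuous_dot d : continuous (fun x : 'rV[R]_d => dot x x).
Proof.
apply: continuous_sumr => i.
by apply: continuous_mul2; exact: continuous_entry.
Qed.

Lemma continuous_enorm d : continuous (fun x : 'rV[R]_d => enorm x).
Proof.
move=> x; apply: (@continuous_comp _ _ _ (fun x : 'rV[R]_d => dot x x) Num.sqrt).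
  exact: continuous_dot.
exact: sqrt_continuous.
Qed.

Lemma closed_le_continuous (T : topologicalType) (f : T -> R) (c : R) :
  continuous f -> closed [set x | f x <= c].
Proof.
by move=> cf; apply: (@preimage_closed _ _ f [set y | y <= c]) => //; exact: closed_le.
Qed.

Lemma closed_eq_continuous (T : topologicalType) (f : T -> R) (c : R) :
  continuous f -> closed [set x | f x = c].
Proof.
by move=> cf; apply: (@preimage_closed _ _ f [set y | y = c]) => //; exact: closed_eq.
Qed.

Lemma compact_closed_mx m n (A : set 'M[R]_(m, n)) : compact A -> closed A.
Proof. by apply: compact_closed; exact: norm_hausdorff. Qed.

End MatrixTopology.

(** * Volume of zonotopes *)

Section Zonotope.
Context {R : realType}.
Local Notation mR := (measurableTypeR R).
Local Notation leb := (@lebesgue_measure R).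

Definition unit_cube n : set 'rV[R]_n := [set t | forall i, `|t ord0 i| <= 1].

(** The Minkowski sum of the segments from -b to b, for the rows b of [a]. Its support function at y
    is \sum_i |<y, a_i>|. *)
Definition zonotope n k (a : 'M[R]_(n, k)) : set 'rV[R]_k :=
  [set t *m a | t in @unit_cube n].

Lemma compact_unit_cube n : compact (@unit_cube n).
Proof.
rewrite (_ : @unit_cube n = [set t | forall i, `[- 1, 1]%classic (t ord0 i)]).
  by apply: (@rV_compact R n (fun=> `[- 1, 1]%classic)) => _; exact: segment_compact.
by apply/seteqP; split=> t /= h i; have := h i; rewrite /= in_itv /= ler_norml.
Qed.

Lemma compact_zonotope n k (a : 'M[R]_(n, k)) : compact (zonotope a).
Proof.
apply: continuous_compact; last exact: compact_unit_cube.
by apply: continuous_subspaceT; exact: continuous_mulmxr.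
Qed.

Lemma rmeasurable_compact n (A : set 'rV[R]_n) : compact A -> rmeasurable A.
Proof. by move=> /compact_closed_mx; exact: rmeasurable_closed. Qed.

Lemma zonotopeM n k m (a : 'M[R]_(n, k)) (M : 'M[R]_(k, m)) :
  zonotope (a *m M) = [set x *m M | x in zonotope a].
Proof.
apply/seteqP; split=> [_ [t tc <-]|_ [_ [t tc <-] <-]].
  by exists (t *m a); [exists t|rewrite mulmxA].
by exists t => //; rewrite mulmxA.
Qed.

Lemma unit_cube_row_mx n (s : R) (t : 'rV[R]_n) :
  unit_cube (row_mx s%:M t : 'rV_(1 + n)) <-> `|s| <= 1 /\ unit_cube t.
Proof.
split=> [h|[hs ht] i].
  split=> [|i].
    by have := h (lshift n ord0); rewrite row_mxEl mxE eqxx.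
  by have := h (rshift 1 i); rewrite row_mxEr.
rewrite mxE; case: splitP => j _; last exact: ht.
by rewrite (ord1 j) mxE eqxx.
Qed.

Lemma zonotope_col_mx n k (b : 'rV[R]_k) (a : 'M[R]_(n, k)) x :
  zonotope (col_mx b a : 'M[R]_(1 + n, k)) x <->
  exists2 s, `|s| <= 1 & zonotope a (x - s *: b).
Proof.
split=> [[t tc <-]|[s s1 [t tc tE]]].
  exists (lsubmx (t : 'rV_(1 + n)) ord0 ord0).
    by rewrite mxE; exact: tc.
  exists (rsubmx (t : 'rV_(1 + n))); first by move=> i; rewrite mxE; exact: tc.
  rewrite -{2}[t](@hsubmxK _ 1 1 n) mul_row_col.
  by rewrite [lsubmx _ in X in X - _]mx11_scalar mul_scalar_mx addrC addKr.
exists (row_mx s%:M t); first exact/unit_cube_row_mx.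
by rewrite mul_row_col mul_scalar_mx tE addrC subrK.
Qed.

Lemma zonotope_ex_norm n k (a : 'M[R]_(n, k)) x j :
  zonotope a x -> `|x ord0 j| <= \sum_i `|a i j|.
Proof.
move=> [t tc <-]; rewrite mxE (le_trans (ler_norm_sum _ _ _)) //.
by apply: ler_sum => i _; rewrite normrM ler_piMl.
Qed.

Lemma zonotope_convex n k (a : 'M[R]_(n, k)) x y (p : R) : 0 <= p <= 1 ->
  zonotope a x -> zonotope a y -> zonotope a (p *: x + (1 - p) *: y).
Proof.
move=> /andP[p0 p1] [t tc <-] [u uc <-].
exists (p *: t + (1 - p) *: u); last by rewrite mulmxDl -!scalemxAl.
move=> i; rewrite !mxE (le_trans (ler_normD _ _)) // !normrM.
rewrite (ger0_norm p0) (ger0_norm (_ : 0 <= 1 - p)) ?subr_ge0 //.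
have q0 : 0 <= 1 - p by rewrite subr_ge0.
have := ler_wpM2l p0 (tc i); have := ler_wpM2l q0 (uc i); lra.
Qed.

(** A non-empty compact convex set of reals is a segment [[l, u]], possibly a point, and its sum
    with [[-1, 1]] is [[l - 1, u + 1]]. *)
Lemma lebesgue_thicken (F : set R) : compact F -> F !=set0 ->
  (forall x y p, 0 <= p <= 1 -> F x -> F y -> F (p * x + (1 - p) * y)) ->
  leb [set x | exists2 s, `|s| <= 1 & F (x - s)] = (leb F + 2%:E)%E.
Proof.
move=> cF F0 cvF.
have cid : {within F, continuous (fun x : R => x)}.
  by apply: continuous_subspaceT => x; exact: cvg_id.
have [l + lmin] := compact_EVT_min F0 cF cid.
have [u + umax] := compact_EVT_max F0 cF cid.
move=> /set_mem Fu /set_mem Fl.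
have lu : l <= u by apply: lmin; exact/mem_set.
have FE x : F x <-> l <= x <= u.
  split=> [Fx|/andP[lx xu]].
    by apply/andP; split; [apply: lmin|apply: umax]; exact/mem_set.
  have [ul|ul] := eqVneq l u.
    suff -> : x = l by [].
    by apply/eqP; rewrite eq_le lx andbT ul xu.
  have d0 : 0 < u - l by rewrite subr_gt0 lt_neqAle ul.
  have -> : x = (u - x) / (u - l) * l + (1 - (u - x) / (u - l)) * u.
    by field; rewrite gt_eqF.
  apply: cvF => //; apply/andP; split.
    by rewrite divr_ge0 ?subr_ge0.
  by rewrite ler_pdivrMr // mul1r lerD2l lerN2.
have -> : F = [set` `[l, u]].
  by apply/seteqP; split=> x /=; rewrite in_itv /= => /FE.
have -> : [set x | exists2 s, `|s| <= 1 & [set` `[l, u]] (x - s)] = [set` `[l - 1, u + 1]].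
  apply/seteqP; split=> x /=.
    move=> [s]; rewrite ler_norml !in_itv /= => /andP[s1 s2] /andP[h1 h2].
    by apply/andP; split; lra.
  rewrite in_itv /= => /andP[h1 h2].
  have [xl|xl] := ltP x l.
    exists (x - l); rewrite ?in_itv /= ?ler_norml; apply/andP; split; lra.
  have [xu|xu] := ltP u x.
    exists (x - u); rewrite ?in_itv /= ?ler_norml; apply/andP; split; lra.
  by exists 0; rewrite ?in_itv /= ?normr0 ?ler01 // subr0 xl.
rewrite !lebesgue_measure_itv /= !lte_fin.
have -> : l - 1 < u + 1 by lra.
case: ltP => h.
  by rewrite -!EFinB -EFinD; congr _%:E; ring.
rewrite add0e -EFinB; congr _%:E.
have -> : l = u by apply/eqP; rewrite eq_le lu h.
by ring.
Qed.

(* Every nonempty fibre in the direction of the new generator is a segment, which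
   becomes longer by 2. *)
Lemma volume_zonotope_delta n k (a : 'M[R]_(n, 1 + k)) :
  volume (zonotope (col_mx (delta_mx ord0 ord0 : 'rV_(1 + k)) a)) =
  (volume (zonotope a) + 2%:E * volume (zonotope (rsubmx a)))%E.
Proof.
have mZ m q (c : 'M[R]_(m, q)) : rmeasurable (zonotope c).
  by apply: rmeasurable_compact; exact: compact_zonotope.
have e0E (x s : R) (y : 'rV[R]_k) :
    row_mx x%:M y - s *: (delta_mx ord0 ord0 : 'rV_(1 + k)) = row_mx (x - s)%:M y.
  apply/rowP => i; rewrite !mxE; case: splitP => j /= ij.
    rewrite !mxE (ord1 j) eqxx [i == _](_ : _ = true) ?mulr1 //.
    by apply/eqP/val_inj; rewrite /= ij (ord1 j).
  by rewrite [i == _](_ : _ = false) ?andbF ?mulr0 ?subr0 // -val_eqE /= ij.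
rewrite !volume_rec_swap //.
rewrite (volumeE (zonotope (rsubmx a))) -[X in tuple_measure k X]setIT -integral_indic //; last exact: mZ.
rewrite -ge0_integralZl_EFin //; last by apply/measurable_EFinP; apply: measurable_indic; exact: mZ.
rewrite -ge0_integralD //; last 2 first.
- exact: measurable_leb_section.
- by apply/measurable_EFinP; apply: measurable_funM => //; apply: measurable_indic; exact: mZ.
apply: eq_integral => t _ /=; set y := rowof t.
set F := [set x | zonotope a (row_mx x%:M y)].
have -> : [set x : mR | zonotope (col_mx (delta_mx ord0 ord0 : 'rV_(1 + k)) a) (row_mx x%:M y)] =
    [set x : R | exists2 s, `|s| <= 1 & F (x - s)].
  apply/seteqP; split=> x /=; rewrite zonotope_col_mx => -[s s1];
    by rewrite ?e0E => h; exists s => //; rewrite e0E.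
have FZ x : F x -> zonotope (rsubmx a) y.
  by move=> [u uc uE]; exists u => //; rewrite mulmx_rsub uE row_mxKr.
(* The fibre is non-empty exactly over the projection of the zonotope along the first axis, which is
   the zonotope of [rsubmx a]; the gain of 2 is integrated over that projection. *)
have [yZ|yZ] := pselect (zonotope (rsubmx a) y); last first.
  rewrite indicE memNset // mule0 adde0; congr (leb _); apply/seteqP.
  by split=> x /= => [[s _ /FZ]|/FZ].
rewrite lebesgue_thicken.
- by rewrite indicE mem_set // mule1.
- have FC x : F x -> `|x| <= \sum_i `|a i (lshift k ord0)|.
    by move=> /(zonotope_ex_norm (lshift k ord0)); rewrite row_mxEl mxE eqxx mulr1n.
  set C := \sum_i _ in FC.
  apply: (subclosed_compact _ (@segment_compact _ (- C) C)); last first.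
    by move=> x /FC; rewrite ler_norml /= in_itv.
  apply: (@preimage_closed _ _ (fun x : R => row_mx x%:M y) (zonotope a)).
    move=> x _; apply: continuous_coords => i j.
    case: (split_ordP j) => j' ->.
      rewrite (_ : (fun _ => _) = id); first by move=> z; exact: cvg_id.
      by apply/funext => r; rewrite row_mxEl mxE !ord1 eqxx mulr1n.
    rewrite (_ : (fun _ => _) = cst (y i j')); first exact: cst_continuous.
    by apply/funext => r; rewrite row_mxEr.
  by apply: compact_closed_mx; exact: compact_zonotope.
- case: yZ => u uc uE; exists ((u *m lsubmx a) ord0 ord0); exists u => //.
  by rewrite -uE -mx11_scalar -mul_mx_row hsubmxK.
- move=> x x' p p01 Fx Fx'.
  rewrite /F /= (_ : row_mx _ _ = p *: row_mx x%:M y + (1 - p) *: row_mx x'%:M y).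
    exact: zonotope_convex.
  rewrite !scale_row_mx add_row_mx -scalerDl [p + _]addrC subrK scale1r; congr row_mx.
  by rewrite raddfD /= !scale_scalar_mx.
Qed.

Lemma volume_image n (A : set 'rV[R]_n) (M : 'M[R]_n) : M \in unitmx ->
  compact A -> volume [set x *m M | x in A] = (`|\det M|%:E * volume A)%E.
Proof.
move=> uM cA; rewrite (volume_linear uM).
  congr (_ * volume _)%E; apply/seteqP; split=> [x [y Ay yx]|x Ax]; last by exists x.
  by rewrite -[x](mulmxK uM) -yx mulmxK.
apply: rmeasurable_compact; apply: continuous_compact cA.
by apply: continuous_subspaceT; exact: continuous_mulmxr.
Qed.

Lemma volume_coord0 n (A : set 'rV[R]_(1 + n)) : rmeasurable A ->
  (forall x, A x -> x ord0 ord0 = 0) -> volume A = 0%E.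
Proof.
move=> mA A0; rewrite volume_rec_swap // integral0_eq // => t _.
apply: (@subset_measure0 _ _ _ leb _ [set (0 : R)]) => //; last exact: lebesgue_measure_set1.
  exact: rmeasurable_leb_section.
move=> x /= /A0; rewrite mxE; case: splitP => // j _.
by rewrite (ord1 j) mxE eqxx.
Qed.

(** Induction on the number of generators. An invertible [Q], a Householder matrix scaled by |b|,
    takes e_0 to the first generator b and multiplies both sides by |\det Q|. Then both sides obey
    the same recursion: the factor 2 from the volume matches the factor k + 1 from [detsum_delta],
    as 2 (2^k / k!) = (2^(k+1) / (k+1)!) (k + 1). *)
Lemma volume_zonotope n k (a : 'M[R]_(n, k)) :
  volume (zonotope a) = (2 ^+ k / k`!%:R * detsum a)%:E.
Proof.
have dim0 m (c : 'M[R]_(m, 0)) : volume (zonotope c) = (2 ^+ 0 / 0`!%:R * detsum c)%:E.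
  rewrite detsum_dim0 expr0 fact0 divr1 mulr1 /volume /= diracE mem_set //.
  by exists 0; rewrite ?mul0mx; [move=> i; rewrite mxE normr0|rewrite [RHS]thinmx0].
elim: n k a => [|n IH] [|k] a; rewrite ?dim0 //.
  rewrite detsum_count0 mulr0; apply: volume_coord0.
    by apply: rmeasurable_compact; exact: compact_zonotope.
  by move=> x [t _ <-]; rewrite mxE big_ord0.
rewrite -[a](@vsubmxK _ 1 n).
set b := usubmx _; set c := dsubmx _.
have [b0|b0] := eqVneq b 0.
  rewrite b0 detsum_col0 -IH; congr volume; apply/seteqP; split=> x.
    by rewrite zonotope_col_mx => -[s _]; rewrite scaler0 subr0.
  move=> cx; rewrite zonotope_col_mx.
  by exists 0; rewrite ?normr0 // scale0r subr0.
have [Q uQ bQ] : exists2 Q : 'M[R]_(1 + k), Q \in unitmx & delta_mx ord0 ord0 *m Q = b.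
  have [P PP bP] := householder b.
  exists (enorm b *: P^T).
    have uP : P \in unitmx by case/mulmx1_unit: PP.
    by rewrite unitmxZ ?unitmx_tr // unitfE enorm_eq0.
  by rewrite -scalemxAr scalemxAl -bP -mulmxA PP mulmx1.
have -> : col_mx b c = col_mx (delta_mx ord0 ord0) (c *m invmx Q) *m Q.
  by rewrite mul_col_mx bQ mulmxKV.
rewrite zonotopeM detsumM volume_image //; last exact: compact_zonotope.
rewrite volume_zonotope_delta detsum_delta !IH -EFinM; congr _%:E.
move: (detsum (c *m _)) (detsum (rsubmx _)) `|\det Q| => x y z.
rewrite add1n exprS factS natrM.
have k0 : k`!%:R != 0 :> R by rewrite pnatr_eq0 -lt0n fact_gt0.
have k1 : 1 + k%:R != 0 :> R by rewrite nat1r pnatr_eq0.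
by field; rewrite k0 ?k1 ?[k%:R + 1]addrC ?k1.
Qed.
End Zonotope.

(** * Separation and diagonalisation by compactness *)

Section ConvexGeometry.
Context {R : realType}.

(** The first-order condition at an extremum when the perturbation is known up to a quadratic error;
    it stands in for differentiation in the separation, diagonalisation and minimisation
    arguments. *)
Lemma le0_of_quadratic (a b : R) :
  (forall t, 0 < t -> t <= 1 -> a * t <= b * t ^+ 2) -> a <= 0.
Proof.
move=> h; rewrite leNgt; apply/negP => a0.
have b0 : 0 < b by have := h 1 ltr01 (lexx _); rewrite expr1n !mulr1; exact: lt_le_trans.
(* With this choice b t <= a / 2 < a, against the hypothesis at t. *)
set t := Num.min 1 (a / (2 * b)).
have t0 : 0 < t by rewrite /t lt_min ltr01 divr_gt0 // mulr_gt0.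
have t1 : t <= 1 by rewrite /t ge_min lexx.
have tb : t * (2 * b) <= a by rewrite -ler_pdivlMr ?mulr_gt0 // /t ge_min lexx orbT.
have := h t t0 t1; rewrite expr2 mulrA ler_pM2r // => ab.
by have : b * t < a; [nra|rewrite ltNge ab].
Qed.

(* The nearest point of [K] gives the separating direction [z - c]. *)
Lemma convex_separation d (K : set 'rV[R]_d) (z : 'rV[R]_d) : compact K ->
  (forall x y p, 0 <= p <= 1 -> K x -> K y -> K (p *: x + (1 - p) *: y)) ->
  (forall y, exists2 x, K x & dot y z <= dot y x) -> K z.
Proof.
move=> cK cvK sup.
pose f (x : 'rV[R]_d) := enorm (x - z).
have cf : continuous f.
  have cs : continuous (fun x : 'rV[R]_d => x - z).
    by move=> x; exact: (cvgB (@cvg_id _ (nbhs x)) (@cst_continuous _ _ z x)).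
  by move=> x; exact: (continuous_comp (cs x) (@continuous_enorm _ _ _)).
have K0 : K !=set0 by have [x Kx _] := sup 0; exists x.
have [c /set_mem Kc cmin] := compact_EVT_min K0 cK (continuous_subspaceT cf).
have [x Kx xw] := sup (z - c).
have [w zE] : exists w, z = c + w by exists (z - c); rewrite addrC subrK.
(* A move from the nearest point [c] towards [x] stays in [K] and cannot approach [z]. As [x]
   satisfies <w, z> <= <w, x>, that is <w, w> <= <w, x - c>, it follows that w = 0. *)
have le0 : dot w (x - c) <= 0.
  suff : 2 * dot w (x - c) <= 0 by lra.
  apply: (@le0_of_quadratic _ (dot (x - c) (x - c))) => t t0 t1.
  have Kt : K (t *: x + (1 - t) *: c) by apply: cvK; rewrite ?(ltW t0).
  have := cmin _ (mem_set Kt).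
  rewrite /f zE -(@ler_pXn2r _ 2) ?nnegrE ?enorm_ge0 // !enorm_sqr.
  have -> : t *: x + (1 - t) *: c - (c + w) = t *: (x - c) - w.
    by apply/rowP => i; rewrite !mxE; ring.
  have -> : c - (c + w) = - w by rewrite opprD addNKr.
  move: (x - c) => u; rewrite !(dotDl, dotDr, dotNl, dotNr, dotZl, dotZr) (dotC u w).
  by lra.
have : dot w w <= 0.
  move: xw le0; rewrite zE [c + w - c]addrAC subrr add0r !(dotDr, dotNr); lra.
rewrite le_eqVlt ltNge dotxx_ge0 orbF dotxx_eq0 => /eqP w0.
by rewrite zE w0 addr0.
Qed.

Lemma dot_zonotope n d (a : 'M[R]_(n, d)) (t : 'rV[R]_n) y :
  dot y (t *m a) = \sum_i t ord0 i * dot y (row i a).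
Proof.
rewrite dotC dot_mulmx; apply: eq_bigr => i _; congr (_ * _).
rewrite mxE; apply: eq_bigr => j _; by rewrite !mxE.
Qed.

Lemma zonotope_support_le n d (a : 'M[R]_(n, d)) x y :
  zonotope a x -> dot y x <= \sum_i `|dot y (row i a)|.
Proof.
move=> [t tc <-]; rewrite dot_zonotope (le_trans (ler_norm _)) //.
rewrite (le_trans (ler_norm_sum _ _ _)) //; apply: ler_sum => i _.
by rewrite normrM ler_piMl.
Qed.

Lemma zonotope_support_eq n d (a : 'M[R]_(n, d)) y :
  exists2 x, zonotope a x & dot y x = \sum_i `|dot y (row i a)|.
Proof.
exists ((\row_i Num.sg (dot y (row i a))) *m a).
  by eexists; last reflexivity; move=> i; rewrite mxE normr_sg; case: eqP.
by rewrite dot_zonotope; apply: eq_bigr => i _; rewrite mxE -normrEsg.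
Qed.

(** Heine-Borel for matrices, transported from row vectors along [vec_mx]. *)
Lemma compact_bounded_mx m n (A : set 'M[R]_(m, n)) (C : R) :
  closed A -> (forall M, A M -> forall i j, `|M i j| <= C) -> compact A.
Proof.
move=> clA bA.
have cvec : continuous (@vec_mx R m n).
  apply: continuous_coords => i j.
  rewrite (_ : (fun x => _) = (fun x : 'rV[R]_(m * n) => x ord0 (mxvec_index i j))).
    exact: continuous_entry.
  by apply/funext => x; rewrite mxE.
rewrite (_ : A = vec_mx @` [set v | A (vec_mx v)]); last first.
  apply/seteqP; split=> [M AM|_ [v Av <-]//].
  by exists (mxvec M); rewrite /= mxvecK.
apply: continuous_compact; first exact: continuous_subspaceT.
apply: (subclosed_compact _ (@rV_compact R _ (fun=> `[- C, C]%classic) _)).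
- exact: (@preimage_closed _ _ vec_mx A (fun x _ => cvec x)).
- by move=> _; exact: segment_compact.
move=> v Av k /=; rewrite in_itv /= -ler_norml.
by case/mxvec_indexP: k => i j; rewrite -[v]vec_mxK mxvecE; exact: bA.
Qed.

(* An orthogonal [W] maximising the sum of [i * S_ii], with [S = W G W^T], is
   stationary under rotations of rows [i] and [j]; the derivative is
   [2 (i - j) S_ij]. *)
Lemma symmetric_diagonalization d (G : 'M[R]_d) : G^T = G ->
  exists2 W : 'M[R]_d, W *m W^T = 1%:M & is_diag_mx (W *m G *m W^T).
Proof.
move=> GT.
pose A : set 'M[R]_d := [set W | W *m W^T = 1%:M].
have clA : closed A.
  rewrite (_ : A = \bigcap_(p in [set: 'I_d * 'I_d])
      [set W | (W *m W^T) p.1 p.2 = (1%:M : 'M[R]_d) p.1 p.2]); last first.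
    apply/seteqP; split=> [W AW p _|W hW] /=; first by rewrite AW.
    by apply/matrixP => i j; exact: (hW (i, j)).
  apply: closed_bigI => -[i j] _; apply: closed_eq_continuous.
  rewrite (_ : (fun x => _) = (fun W : 'M[R]_d => \sum_k W i k * W j k)).
    by apply: continuous_sumr => k; apply: continuous_mul2; exact: continuous_entry.
  by apply/funext => W; rewrite mxE; apply: eq_bigr => k _; rewrite mxE.
have A1 (W : 'M[R]_d) : A W -> forall i j, `|W i j| <= 1.
  move=> AW i j; have {AW}: (W *m W^T) i i = 1 by rewrite AW mxE eqxx.
  have -> : (W *m W^T) i i = enorm (row i W) ^+ 2.
    by rewrite enorm_sqr mxE; apply: eq_bigr => k _; rewrite !mxE.
  move=> /eqP; rewrite sqrp_eq1 ?enorm_ge0 // => /eqP <-.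
  by have := coord_le_enorm (row i W) j; rewrite mxE.
pose f (W : 'M[R]_d) := \sum_(i < d) i%:R * (W *m G *m W^T) i i.
have cf : continuous f.
  apply: continuous_sumr => i; apply: continuous_mul2; first exact: cst_continuous.
  rewrite (_ : (fun x => _) = (fun W : 'M[R]_d => \sum_k (W *m G) i k * W i k)).
    apply: continuous_sumr => k; apply: continuous_mul2; last exact: continuous_entry.
    by move=> W; exact: (continuous_comp (@continuous_mulmxr _ _ _ _ G W)
      (@continuous_entry _ _ _ i k _)).
  by apply/funext => W; rewrite mxE; apply: eq_bigr => k _; rewrite [W^T _ _]mxE.
have A0 : A !=set0 by exists 1%:M; rewrite /A /= trmx1 mulmx1.
have [W /set_mem AW Wmax] := compact_EVT_max A0 (compact_bounded_mx clA A1) (continuous_subspaceT cf).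
exists W => //; set S := W *m G *m W^T.
have ST : S^T = S by rewrite /S !trmx_mul trmxK GT mulmxA.
apply/is_diag_mxP => i j ijn; have ij : i != j by [].
pose e k : 'rV[R]_d := delta_mx ord0 k.
have ee a b : dot (e a) (e b) = (a == b)%:R.
  by rewrite dotE trmx_delta mul_delta_mx_cond mulmxnE mxE !eqxx.
have eSe a b : dot (e a *m S) (e b) = S a b.
  rewrite /e -rowE /dot (bigD1 b) //= big1 ?addr0 => [|k kb]; rewrite !mxE eqxx /=.
    by rewrite eqxx mulr1.
  by rewrite (negPf kb) mulr0.
(* [Q] rotates the plane of rows i and j by the angle with tangent t, and [c] is its cosine;
   multiplying the comparison of [W] with [Q *m W] by 1 + t^2 clears c^2. *)
have key t : 2 * (i%:R - j%:R) * S i j * t <= (i%:R - j%:R) * (S i i - S j j) * t ^+ 2.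
  set c : R := (Num.sqrt (1 + t ^+ 2))^-1.
  have n0 : 0 < 1 + t ^+ 2 by rewrite ltr_wpDr ?sqr_ge0.
  have c2 : c * c = (1 + t ^+ 2)^-1 by rewrite -expr2 exprVn sqr_sqrtr // ltW.
  pose q k : 'rV[R]_d := if k == i then c *: (e i + t *: e j)
    else if k == j then c *: (e j - t *: e i) else e k.
  pose Q : 'M[R]_d := \matrix_k q k.
  have qq k l : dot (q k) (q l) = (k == l)%:R.
    have cc1 : c * c * (1 + t ^+ 2) = 1 by rewrite c2 mulVf // gt_eqF.
    have ji : j != i by rewrite eq_sym.
    have qi : q i = c *: (e i + t *: e j) by rewrite /q eqxx.
    have qj : q j = c *: (e j - t *: e i) by rewrite /q (negPf ji) eqxx.
    have qo r : r != i -> r != j -> q r = e r by move=> ri rj; rewrite /q (negPf ri) (negPf rj).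
    have cases r : [\/ r = i, r = j | [&& r != i, r != j, i != r & j != r]].
      rewrite ![_ == r]eq_sym; case: (r =P i) => [?|ri]; first exact: Or31.
      by case: (r =P j) => [?|rj]; [exact: Or32|exact: Or33].
    clearbody q c e.
    case: (cases k) => [->|->|/and4P[ki kj ik jk]];
      case: (cases l) => [->|->|/and4P[li lj il jl]];
      rewrite ?qi ?qj ?qo // !(dotDl, dotDr, dotNl, dotNr, dotZl, dotZr) !ee ?eqxx
        ?(negPf ij) ?(negPf ji) ?(negPf ki) ?(negPf kj) ?(negPf il) ?(negPf jl) /=;
      by [ring|rewrite -[RHS]cc1; ring].
  have AQ : A (Q *m W).
    rewrite /A /= trmx_mul mulmxA -(mulmxA Q) AW mulmx1.
    by apply/matrixP => k l; rewrite !mxE -qq; apply: eq_bigr => r _; rewrite !mxE.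
  have := Wmax _ (mem_set AQ); rewrite /f.
  have QE k : (Q *m W *m G *m (Q *m W)^T) k k = dot (q k *m S) (q k).
    have -> : Q *m W *m G *m (Q *m W)^T = Q *m S *m Q^T by rewrite trmx_mul !mulmxA.
    rewrite mxE /dot -[q k](rowK q) -row_mul.
    by apply: eq_bigr => r _; rewrite !mxE.
  under eq_bigr do rewrite QE.
  rewrite -/S.
  rewrite (bigD1 i) //= [X in _ + X](bigD1 j) 1?eq_sym //= [X in _ <= X](bigD1 i) //=.
  rewrite [X in _ <= _ + X](bigD1 j) 1?eq_sym //= !addrA.
  have -> : \sum_(k | (k != i) && (k != j)) k%:R * dot (q k *m S) (q k) =
      \sum_(k | (k != i) && (k != j)) k%:R * S k k.
    by apply: eq_bigr => k /andP[ki kj]; rewrite /q (negPf ki) (negPf kj) eSe.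
  rewrite lerD2r => /(ler_wpM2r (ltW n0)).
  have Sji : S j i = S i j by rewrite -{1}ST mxE.
  have Di : dot (q i *m S) (q i) * (1 + t ^+ 2) = S i i + 2 * t * S i j + t ^+ 2 * S j j.
    rewrite /q eqxx -scalemxAl mulmxDl -scalemxAl !(dotDl, dotDr, dotZl, dotZr) !eSe Sji.
    by rewrite mulrA c2; field; rewrite gt_eqF.
  have Dj : dot (q j *m S) (q j) * (1 + t ^+ 2) = S j j - 2 * t * S i j + t ^+ 2 * S i i.
    rewrite /q eq_sym (negPf ij) eqxx -scalemxAl mulmxBl -scalemxAl.
    rewrite !(dotDl, dotDr, dotNl, dotNr, dotZl, dotZr) !eSe Sji.
    by rewrite mulrA c2; field; rewrite gt_eqF.
  rewrite mulrDl -!mulrA Di Dj; lra.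
(* The weights in [f] are pairwise distinct for this reason: with equal weights [f] would be a
   multiple of the trace, which rotations do not change. *)
have ijR : i%:R - j%:R != 0 :> R by rewrite subr_eq0 eqr_nat; exact: ijn.
have le1 : 2 * (i%:R - j%:R) * S i j <= 0.
  by apply: le0_of_quadratic => t _ _; exact: key.
have le2 : - (2 * (i%:R - j%:R) * S i j) <= 0.
  by apply: (@le0_of_quadratic _ ((i%:R - j%:R) * (S i i - S j j))) => t _ _; have := key (- t); rewrite mulrN sqrrN mulNr.
have : (i%:R - j%:R) * S i j = 0 by lra.
by move=> /eqP; rewrite mulf_eq0 (negPf ijR) => /eqP.
Qed.
End ConvexGeometry.

(** * Lewis' position and discretisation *)

Section VectorIntegrals.
Context {R : realType} {disp : measure_display} {S : measurableType disp}.
Variable sigma : {measure set S -> \bar R}.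

Definition vmeasurable d (q : S -> 'rV[R]_d) : Prop :=
  forall i, measurable_fun [set: S] (fun x => q x ord0 i).

Definition vintegrable d (q : S -> 'rV[R]_d) : Prop :=
  vmeasurable q /\ sigma.-integrable [set: S] (fun x => (enorm (q x))%:E).

Lemma vmeasurable_dot d (q : S -> 'rV[R]_d) y : vmeasurable q ->
  measurable_fun [set: S] (fun x => dot (q x) y).
Proof. by move=> mq; apply: measurable_sum => i; exact: measurable_funM. Qed.

Lemma vmeasurable_mulmx d k (q : S -> 'rV[R]_d) (T : 'M[R]_(d, k)) : vmeasurable q ->
  vmeasurable (fun x => q x *m T).
Proof.
move=> mq j; rewrite (_ : (fun _ => _) = (fun x => dot (q x) (col j T)^T)).
  exact: vmeasurable_dot.
by apply/funext => x; rewrite mxE; apply: eq_bigr => i _; rewrite !mxE.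
Qed.

Lemma measurable_invr : measurable_fun [set: R] (fun x : R => x^-1).
Proof.
have -> : [set: R] = [set x | x != 0] `|` [set 0].
  by apply/seteqP; split=> // x _ /=; have [->|] := eqVneq x 0; [right|left].
have m1 : measurable [set x : R | x != 0].
  rewrite (_ : [set x | x != 0] = ~` [set 0]); first exact: measurableC.
  by apply/seteqP; split=> x /=; move/eqP.
apply/measurable_funU => //; split; last exact: measurable_fun_set1.
apply: open_continuous_measurable_fun.
  rewrite (_ : [set x | x != 0] = ~` [set 0]); first exact/closed_openC/closed_eq.
  by apply/seteqP; split=> x /=; move/eqP.
by move=> x /set_mem /= x0; exact: inv_continuous.
Qed.

Lemma vmeasurable_enorm d (q : S -> 'rV[R]_d) : vmeasurable q ->
  measurable_fun [set: S] (fun x => enorm (q x)).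
Proof.
move=> mq; apply: (measurableT_comp (continuous_measurable_fun (@sqrt_continuous R))).
by apply: measurable_sum => i; exact: measurable_funM.
Qed.

Lemma vmeasurable_cov d (q : S -> 'rV[R]_d) i j : vmeasurable q ->
  measurable_fun [set: S] (fun x => q x ord0 i * q x ord0 j / enorm (q x)).
Proof.
move=> mq; apply: measurable_funM; first exact: measurable_funM.
exact: (measurableT_comp measurable_invr (vmeasurable_enorm mq)).
Qed.

Lemma vintegrable_bounded d (q : S -> 'rV[R]_d) (f : S -> R) (C : R) :
  vintegrable q -> measurable_fun [set: S] f ->
  (forall x, `|f x| <= C * enorm (q x)) -> sigma.-integrable [set: S] (EFin \o f).
Proof.
move=> [mq iq] mf fC.
apply: (@le_integrable _ _ _ _ _ _ _ (fun x => C%:E * (enorm (q x))%:E)%E) => //.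
- exact/measurable_EFinP.
- move=> x _; rewrite -EFinM !abse_EFin lee_fin.
  exact: le_trans (fC x) (ler_norm _).
- exact: integrableZl.
Qed.

Lemma enorm_mulmx_le d k (p : 'rV[R]_d) (T : 'M[R]_(d, k)) :
  enorm (p *m T) <= enorm p * \sum_j \sum_i `|T i j|.
Proof.
rewrite (le_trans (enorm_le_sum _)) // mulr_sumr; apply: ler_sum => j _.
rewrite mxE (le_trans (ler_norm_sum _ _ _)) // mulr_sumr; apply: ler_sum => i _.
by rewrite normrM ler_wpM2r // coord_le_enorm.
Qed.

Lemma vintegrable_mulmx d k (q : S -> 'rV[R]_d) (T : 'M[R]_(d, k)) :
  vintegrable q -> vintegrable (fun x => q x *m T).
Proof.
move=> iq; have mqT := vmeasurable_mulmx T iq.1; split=> //.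
apply: (vintegrable_bounded (C := \sum_j \sum_i `|T i j|) iq).
  exact: vmeasurable_enorm.
by move=> x; rewrite ger0_norm ?enorm_ge0 // mulrC; exact: enorm_mulmx_le.
Qed.

Lemma vintegrable_dot d (q : S -> 'rV[R]_d) y : vintegrable q ->
  sigma.-integrable [set: S] (EFin \o (fun x => `|dot (q x) y|)).
Proof.
move=> iq; apply: (vintegrable_bounded (C := enorm y) iq).
  by apply: measurableT_comp => //; exact: (vmeasurable_dot y iq.1).
by move=> x; rewrite normr_id mulrC; exact: dot_le_enorm.
Qed.

(** Makes the isotropy integrand integrable. At p = 0 the quotient is 0 by the convention on the
    inverse of 0. *)
Lemma cov_le d (p : 'rV[R]_d) i j : `|p ord0 i * p ord0 j / enorm p| <= 1 * enorm p.
Proof.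
rewrite mul1r; have [p0|p0] := eqVneq (enorm p) 0; first by rewrite p0 invr0 mulr0 normr0.
have pp : 0 < enorm p by rewrite lt_def p0 enorm_ge0.
rewrite normrM normfV (ger0_norm (enorm_ge0 p)) ler_pdivrMr // normrM.
by apply: ler_pM => //; exact: coord_le_enorm.
Qed.

Lemma vintegrable_cov d (q : S -> 'rV[R]_d) i j : vintegrable q ->
  sigma.-integrable [set: S] (EFin \o (fun x => q x ord0 i * q x ord0 j / enorm (q x))).
Proof.
move=> iq; apply: (vintegrable_bounded (C := 1) iq); first exact: (vmeasurable_cov i j iq.1).
by move=> x; exact: cov_le.
Qed.

End VectorIntegrals.

(** * Lewis' position by minimisation under a determinant constraint *)

Section LewisPosition.
Context {R : realType}.

Lemma modulus_continuous (T : topologicalType) (f : T -> R) (g : T -> T -> R) :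
  (forall x, continuous (g x)) -> (forall x, g x x = 0) ->
  (forall x y, `|f x - f y| <= g x y) -> continuous f.
Proof.
move=> cg g0 fg x; apply/cvgrPdist_lt => e e0.
have /cvgrPdist_lt/(_ e e0) := cg x x; apply: filterS => y /=.
rewrite g0 sub0r normrN => gy; apply: le_lt_trans (fg x y) _.
exact: le_lt_trans (ler_norm _) gy.
Qed.

Lemma continuous_dist (T : topologicalType) (f : T -> R) (c : R) :
  continuous f -> continuous (fun x => `|c - f x|).
Proof. by move=> cf x; exact: (cvg_norm (cvgB (@cst_continuous _ _ c x) (cf x))). Qed.

Lemma lipschitz_entries_continuous m n (f : 'M[R]_(m, n) -> R) (C : R) :
  (forall x y, `|f x - f y| <= C * \sum_j \sum_i `|(x - y) i j|) -> continuous f.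
Proof.
move=> fC; apply: (modulus_continuous _ _ fC) => x; last first.
  by rewrite big1 ?mulr0 // => j _; rewrite big1 // => i _; rewrite subrr mxE normr0.
apply: continuous_mul2; first exact: cst_continuous.
apply: continuous_sumr => j; apply: continuous_sumr => i.
rewrite (_ : (fun _ => _) = (fun y : 'M[R]_(m, n) => `|x i j - y i j|)).
  by apply: continuous_dist; exact: continuous_entry.
by apply/funext => z; rewrite !mxE.
Qed.

Lemma det_transvection d (i j : 'I_d) (t : R) : i != j ->
  \det (1%:M + t *: delta_mx i j) = 1.
Proof.
wlog lij : i j / (j < i)%N => [hw|] ij.
  have [ji|] := ltnP j i; first exact: hw.
  rewrite leq_eqVlt => /orP[/eqP/val_inj ijE|lt_ij]; first by rewrite ijE eqxx in ij.
  rewrite -det_tr linearD /= trmx1 linearZ /= trmx_delta.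
  by apply: hw => //; rewrite eq_sym.
rewrite det_trig.
  rewrite big1 // => k _; rewrite !mxE eqxx.
  by have [->|_] := eqVneq k i; rewrite ?(negPf ij) /= mulr0 addr0.
apply/is_trig_mxP => k l kl; rewrite !mxE.
have -> : (k == l) = false by rewrite -val_eqE /= ltn_eqF.
rewrite add0r; have [ki|] := eqVneq k i; last by rewrite mulr0.
have [lj|] := eqVneq l j; last by rewrite mulr0.
by move: kl; rewrite ki lj ltnNge ltnW.
Qed.

(** By AM-GM, |p + w| <= (|p|^2 + |p + w|^2) / (2 |p|). This is the first variation of the norm with
    an explicit quadratic remainder, which can be integrated directly. *)
Lemma enormD_le d (p w : 'rV[R]_d) : p != 0 ->
  enorm (p + w) <= enorm p + (dot p w / enorm p + 2^-1 * (dot w w / enorm p)).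
Proof.
move=> p0; have pp : 0 < enorm p by rewrite lt_def enorm_eq0 p0 enorm_ge0.
have h : dot (p + w) (p + w) = enorm p ^+ 2 + 2 * dot p w + dot w w.
  by rewrite enorm_sqr !(dotDl, dotDr) (dotC w p); ring.
have -> : enorm p + (dot p w / enorm p + 2^-1 * (dot w w / enorm p)) =
    (enorm p ^+ 2 + enorm (p + w) ^+ 2) / (2 * enorm p).
  by rewrite enorm_sqr [enorm (p + w) ^+ 2]enorm_sqr h -!enorm_sqr; field; rewrite gt_eqF.
rewrite ler_pdivlMr ?mulr_gt0 //.
by have := sqr_ge0 (enorm p - enorm (p + w)); lra.
Qed.

Context {disp : measure_display} {S : measurableType disp}.
Variable sigma : {measure set S -> \bar R}.

Local Notation rintegrable f := (sigma.-integrable [set: S] (EFin \o f)).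

Lemma rintegrableD (f g : S -> R) : rintegrable f -> rintegrable g ->
  rintegrable (fun x => f x + g x).
Proof. by move=> hf hg; exact: (integrableD measurableT hf hg). Qed.

Lemma rintegrableZ (c : R) (f : S -> R) : rintegrable f -> rintegrable (fun x => c * f x).
Proof. by move=> hf; exact: (integrableZl measurableT c hf). Qed.

Lemma rintegrable_sum (I : Type) (r : seq I) (f : I -> S -> R) :
  (forall i, rintegrable (f i)) -> rintegrable (fun x => \sum_(i <- r) f i x).
Proof.
move=> hf; elim: r => [|i r IH].
  by under eq_fun do rewrite big_nil; exact: integrable0.
by under eq_fun do rewrite big_cons; exact: rintegrableD.
Qed.

Lemma Rintegral_sum (I : Type) (r : seq I) (f : I -> S -> R) :
  (forall i, rintegrable (f i)) ->
  \int[sigma]_x \sum_(i <- r) f i x = \sum_(i <- r) \int[sigma]_x f i x.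
Proof.
move=> hf; elim: r => [|i r IH].
  rewrite big_nil; under eq_Rintegral do rewrite big_nil.
  by rewrite Rintegral_cst // mul0r.
rewrite big_cons; under eq_Rintegral do rewrite big_cons.
by rewrite RintegralD // ?IH //; exact: rintegrable_sum.
Qed.

(* The minimiser is compared with its products by [1 + t E_ij] and by the diagonal
   matrices with entries [1 + t] and [1 / (1 + t)], all of determinant one. *)
Lemma lewis_position d (v : S -> 'rV[R]_d) : (0 < d)%N -> vintegrable sigma v ->
  (forall y, y != 0 -> 0 < \int[sigma]_x `|dot (v x) y|) ->
  exists2 T : 'M[R]_d, T \in unitmx &
    let q x := v x *m T in
    \int[sigma]_x enorm (q x) = d%:R /\
    forall i j, \int[sigma]_x (q x ord0 i * q x ord0 j / enorm (q x)) = (i == j)%:R.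
Proof.
move=> d0 iv nondeg.
have int_enorm k (T : 'M[R]_(d, k)) :
    sigma.-integrable setT (EFin \o (fun x => enorm (v x *m T))).
  by have [] := vintegrable_mulmx T iv.
pose N (T : 'M[R]_d) : R := \int[sigma]_x enorm (v x *m T).
pose C : R := \int[sigma]_x enorm (v x).
have int_v : sigma.-integrable setT (EFin \o (fun x => enorm (v x))) by have [] := iv.
have ND T T' : N (T + T') <= N T + N T'.
  rewrite /N -RintegralD //; apply: le_Rintegral => //.
    by apply: rintegrableD; exact: int_enorm.
  by move=> x _; rewrite mulmxDr enormD.
have NC T : N T <= C * \sum_j \sum_i `|T i j|.
  rewrite /N /C -RintegralZr //; apply: le_Rintegral => //.
    by under eq_fun do rewrite mulrC; exact: rintegrableZ.
  by move=> x _; exact: enorm_mulmx_le.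
have cN : continuous N.
  apply: (@lipschitz_entries_continuous _ _ _ C) => T T'.
  have le_dist (X Y : 'M[R]_d) : N X - N Y <= C * \sum_j \sum_i `|(X - Y) i j|.
    by rewrite lerBlDl (le_trans _ (lerD (lexx _) (NC _))) // -{1}[X](subrK Y) addrC ND.
  rewrite ler_norml le_dist andbT lerNl opprB.
  apply: le_trans (le_dist T' T) _; rewrite -opprB.
  by under eq_bigr do under eq_bigr do rewrite mxE normrN.
pose h (y : 'rV[R]_d) := \int[sigma]_x `|dot (v x) y|.
have int_h y : rintegrable (fun x => `|dot (v x) y|) by exact: vintegrable_dot.
have hZ a y : h (a *: y) = `|a| * h y.
  by rewrite /h -RintegralZl //; apply: eq_Rintegral => x _; rewrite dotZr normrM.
have hD y z : h (y + z) <= h y + h z.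
  rewrite /h -RintegralD //; apply: le_Rintegral => //; first exact: rintegrableD.
  by move=> x _; rewrite dotDr ler_normD.
have hC y : h y <= C * \sum_j \sum_i `|y i j|.
  rewrite /h /C -RintegralZr //; apply: le_Rintegral => //.
    by under eq_fun do rewrite mulrC; exact: rintegrableZ.
  move=> x _; rewrite (le_trans (dot_le_enorm _ _)) // ler_wpM2l ?enorm_ge0 //.
  by under eq_bigr do rewrite big_ord1; exact: enorm_le_sum.
have ch : continuous h.
  apply: (@lipschitz_entries_continuous _ _ _ C) => y z.
  have le_dist (a b : 'rV[R]_d) : h a - h b <= C * \sum_j \sum_i `|(a - b) i j|.
    by rewrite lerBlDl (le_trans _ (lerD (lexx _) (hC _))) // -{1}[a](subrK b) addrC hD.
  rewrite ler_norml le_dist andbT lerNl opprB.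
  apply: le_trans (le_dist z y) _; rewrite -opprB.
  by under eq_bigr do under eq_bigr do rewrite mxE normrN.
pose i0 : 'I_d := Ordinal d0.
(* [c] is the minimum of the continuous positive function [h] on the unit sphere. Applied to the
   columns of [T], this bounds the entries of [T] by N T / c. *)
have [c c0 hc] : exists2 c, 0 < c & forall y, c * enorm y <= h y.
  pose B : set 'rV[R]_d := [set y | enorm y = 1].
  have cB : compact B.
    apply: (@compact_bounded_mx _ _ _ _ 1).
      by apply: closed_eq_continuous; exact: continuous_enorm.
    by move=> y y1 i j; rewrite (ord1 i) -y1 coord_le_enorm.
  have B0 : B !=set0.
    exists (delta_mx ord0 i0); rewrite /B /= /enorm dotE trmx_delta mul_delta_mx mxE.
    by rewrite !eqxx sqrtr1.
  have [y0 /set_mem y01 y0min] := compact_EVT_min B0 cB (continuous_subspaceT ch).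
  exists (h y0).
    by apply: nondeg; apply/eqP => y00; move: y01; rewrite /B /= y00 /enorm dot0l sqrtr0 => /eqP;
      rewrite eq_sym oner_eq0.
  move=> y; have [->|yn0] := eqVneq y 0.
    by rewrite /enorm dot0l sqrtr0 mulr0; apply: Rintegral_ge0.
  have yp : 0 < enorm y by rewrite lt_def enorm_eq0 yn0 enorm_ge0.
  rewrite -ler_pdivlMr // mulrC -[X in X * _]ger0_norm ?invr_ge0 ?enorm_ge0 // -hZ.
  apply: y0min; apply/mem_set; rewrite /B /= enormZ ger0_norm ?invr_ge0 ?enorm_ge0 //.
  by rewrite mulVf // gt_eqF.
have Nentry (T : 'M[R]_d) i j : `|T i j| <= N T / c.
  rewrite ler_pdivlMr // mulrC.
  have -> : T i j = (col j T)^T ord0 i by rewrite !mxE.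
  apply: le_trans (ler_wpM2l (ltW c0) (coord_le_enorm _ i)) _.
  apply: le_trans (hc _) _; apply: le_Rintegral => // x _.
  have -> : dot (v x) (col j T)^T = (v x *m T) ord0 j.
    by rewrite mxE; apply: eq_bigr => k _; rewrite !mxE.
  exact: coord_le_enorm.
(* The second constraint makes the set bounded and loses no minimiser, because the identity is a
   competitor. *)
pose A : set 'M[R]_d := [set T | \det T = 1] `&` [set T | N T <= N 1%:M].
have cA : compact A.
  apply: (@compact_bounded_mx _ _ _ _ (N 1%:M / c)).
    apply: closedI; first by apply: closed_eq_continuous; exact: continuous_det.
    exact: closed_le_continuous.
  by move=> T [_ NT] i j; rewrite (le_trans (Nentry T i j)) // ler_pM2r ?invr_gt0.
have A0 : A !=set0 by exists 1%:M; split; rewrite /= ?det1.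
have [T0 /set_mem[detT0 NT0] T0min] := compact_EVT_min A0 cA (continuous_subspaceT cN).
have {}T0min T : \det T = 1 -> N T0 <= N T.
  move=> detT; have [NT|NT] := leP (N T) (N 1%:M); first by apply: T0min; exact/mem_set.
  exact: le_trans NT0 (ltW NT).
have uT0 : T0 \in unitmx by rewrite unitmxE detT0 unitr1.
pose p x := v x *m T0.
have ip : vintegrable sigma p by exact: vintegrable_mulmx.
pose m i j := \int[sigma]_x (p x ord0 i * p x ord0 j / enorm (p x)).
have int_m i j : rintegrable (fun x => p x ord0 i * p x ord0 j / enorm (p x)).
  exact: vintegrable_cov.
have m_ge0 i : 0 <= m i i.
  by apply: Rintegral_ge0 => x _; rewrite divr_ge0 ?enorm_ge0 // -expr2 sqr_ge0.
(* Minimality of [T0] against [T0 *m (1 + G)], with the norm bounded pointwise by [enormD_le]; where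
   p x = 0 both norms vanish. *)
have variation G (f : S -> R) : \det (1%:M + G) = 1 -> rintegrable f ->
    (forall x, dot (p x) (p x *m G) / enorm (p x) +
      2^-1 * (dot (p x *m G) (p x *m G) / enorm (p x)) = f x) ->
    0 <= \int[sigma]_x f x.
  move=> detG intf fE.
  have := T0min (T0 *m (1%:M + G)); rewrite det_mulmx detT0 detG mulr1 => /(_ erefl) h1.
  rewrite -(lerD2l (N T0)) addr0 (le_trans h1) // /N -RintegralD //.
  apply: le_Rintegral => //; first exact: rintegrableD.
  move=> x _; rewrite mulmxA mulmxDr mulmx1 -/(p x) -fE.
  have [->|px0] := eqVneq (p x) 0; last exact: enormD_le.
  by rewrite mul0mx addr0 !dot0l !mul0r mulr0 !addr0.
have pdelta x i j : p x *m delta_mx i j = p x ord0 i *: delta_mx ord0 j.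
  apply/rowP => k; rewrite !mxE (bigD1 i) //= big1 ?addr0 => [|l li]; rewrite !mxE.
    by rewrite !eqxx.
  by rewrite (negPf li) mulr0.
have pe x j : dot (p x) (delta_mx ord0 j) = p x ord0 j.
  rewrite /dot (bigD1 j) //= big1 ?addr0 => [|l lj]; rewrite !mxE eqxx /=.
    by rewrite eqxx mulr1.
  by rewrite (negPf lj) mulr0.
have ee (a b : 'I_d) : dot (delta_mx ord0 a : 'rV[R]_d) (delta_mx ord0 b) = (a == b)%:R.
  by rewrite dotE trmx_delta mul_delta_mx_cond mulmxnE mxE !eqxx.
have m_off_le i j t : i != j -> 0 <= t * m i j + 2^-1 * t ^+ 2 * m i i.
  move=> ij.
  have -> : t * m i j + 2^-1 * t ^+ 2 * m i i =
      \int[sigma]_x (t * (p x ord0 i * p x ord0 j / enorm (p x)) +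
       2^-1 * t ^+ 2 * (p x ord0 i * p x ord0 i / enorm (p x))).
    by rewrite RintegralD ?RintegralZl //; exact: rintegrableZ.
  apply: (variation (t *: delta_mx i j)); first exact: det_transvection.
    by apply: rintegrableD; exact: rintegrableZ.
  by move=> x; rewrite -scalemxAr pdelta !(dotZl, dotZr) pe ee eqxx /=; ring.
have m_off i j : i != j -> m i j = 0.
  move=> ij.
  have le1 : - m i j <= 0.
    by apply: (@le0_of_quadratic R _ (2^-1 * m i i)) => t _ _; have := m_off_le i j t ij; lra.
  have le2 : m i j <= 0.
    apply: (@le0_of_quadratic R _ (2^-1 * m i i)) => t _ _.
    by have := m_off_le i j (- t) ij; rewrite sqrrN; lra.
  by apply/eqP; rewrite eq_le le2 -oppr_le0.
have m_diag i j : m i i <= m j j.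
  have [->//|ij] := eqVneq i j; have ji : j != i by rewrite eq_sym.
  rewrite -subr_le0; apply: (@le0_of_quadratic R _ (2^-1 * 3 * m i i + 2^-1 * m j j)) => t t0 t1.
  (* 1 + s = 1 / (1 + t) keeps the determinant equal to one. Since s <= - t + t^2 and s^2 <= t^2,
     the terms of second order are at most 3/2 m_ii + 1/2 m_jj times t^2. *)
  set s : R := - t / (1 + t).
  have tp : 0 < 1 + t by rewrite addr_gt0.
  have var : 0 <= t * m j j + s * m i i + (2^-1 * t ^+ 2 * m j j + 2^-1 * s ^+ 2 * m i i).
    pose f k x := p x ord0 k * p x ord0 k / enorm (p x).
    have -> : t * m j j + s * m i i + (2^-1 * t ^+ 2 * m j j + 2^-1 * s ^+ 2 * m i i) =
        \int[sigma]_x ((t + 2^-1 * t ^+ 2) * f j x + (s + 2^-1 * s ^+ 2) * f i x).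
      rewrite RintegralD ?RintegralZl //; try (apply: rintegrableZ; exact: int_m);
        try exact: int_m.
      by rewrite -/(m i i) -/(m j j); ring.
    apply: (variation (t *: delta_mx j j + s *: delta_mx i i)
      (fun x => (t + 2^-1 * t ^+ 2) * f j x + (s + 2^-1 * s ^+ 2) * f i x)).
    - have -> : 1%:M + (t *: delta_mx j j + s *: delta_mx i i) =
          diag_mx (\row_k (1 + t * (k == j)%:R + s * (k == i)%:R)).
        apply/matrixP => k l; rewrite !mxE; have [->|kl] := eqVneq k l.
          by rewrite !andbb mulr1n addrA.
        rewrite mulr0n add0r.
        have -> : (k == j) && (l == j) = false.
          by apply/negP => /andP[/eqP kj /eqP lj]; rewrite kj lj eqxx in kl.
        have -> : (k == i) && (l == i) = false.
          by apply/negP => /andP[/eqP kj /eqP lj]; rewrite kj lj eqxx in kl.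
        by rewrite !mulr0 addr0.
      rewrite det_diag (bigD1 i) //= (bigD1 j) //= big1 => [|k /andP[ki kj]].
        rewrite !mxE !eqxx (negPf ij) (negPf ji) /s /=.
        by field; rewrite gt_eqF.
      by rewrite mxE (negPf ki) (negPf kj) !mulr0 !addr0.
    - by apply: rintegrableD; apply: rintegrableZ; exact: int_m.
    move=> x; rewrite /f mulmxDr -!scalemxAr !pdelta.
    rewrite !(dotDl, dotDr, dotZl, dotZr) !pe !ee !eqxx (negPf ij) (negPf ji) /=.
    by ring.
  have sE : s = - t + t ^+ 2 / (1 + t) by rewrite /s; field; rewrite gt_eqF.
  have r0 : 0 <= t ^+ 2 / (1 + t) by rewrite divr_ge0 ?sqr_ge0 // ltW.
  have r1 : t ^+ 2 / (1 + t) <= t ^+ 2.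
    by rewrite ler_pdivrMr // ler_peMr ?sqr_ge0 // lerDl ltW.
  have s0 : s <= 0 by rewrite /s mulNr oppr_le0 divr_ge0 // ltW.
  have s2 : s ^+ 2 <= t ^+ 2.
    by rewrite -sqrrN ler_pXn2r // ?nnegrE ?oppr_ge0 // ?(ltW t0) // lerNl sE lerDl.
  have := ler_wpM2r (m_ge0 i) r1; have := ler_wpM2r (m_ge0 i) s2.
  by move: var; rewrite {1}sE; lra.
have m_tr : \sum_i m i i = N T0.
  rewrite /m -Rintegral_sum //; apply: eq_Rintegral => x _.
  rewrite -mulr_suml -/(dot (p x) (p x)) -enorm_sqr -/(p x).
  have [->|px0] := eqVneq (enorm (p x)) 0; first by rewrite invr0 mulr0.
  by rewrite expr2 mulfK.
have N0 : 0 < N T0.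
  rewrite ltNge; apply/negP => N0.
  have T00 : T0 = 0.
    apply/matrixP => i j; rewrite mxE; apply/eqP; rewrite -normr_le0.
    by rewrite (le_trans (Nentry T0 i j)) // mulr_le0_ge0 // invr_ge0 ltW.
  have := mulmxV uT0; rewrite T00 mul0mx => /matrixP/(_ i0 i0) /eqP.
  by rewrite !mxE eqxx eq_sym oner_eq0.
have m_eq i : m i i = N T0 / d%:R.
  have dn0 : d%:R != 0 :> R by rewrite pnatr_eq0 -lt0n.
  rewrite -m_tr (eq_bigr (fun=> m i i)) => [|j _]; last first.
    by apply/eqP; rewrite eq_le !m_diag.
  by rewrite sumr_const card_ord -[m i i *+ d]mulr_natr mulfK.
(* The moments m_ij scale linearly under dilation of [p], and m_ii = N T0 / d, so one factor
   normalises both \int |q| and the covariance. *)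
pose a := d%:R / N T0.
have a0 : 0 < a by rewrite divr_gt0 // ltr0n.
exists (a *: T0); first by rewrite unitmxZ // unitfE gt_eqF.
have qE x : v x *m (a *: T0) = a *: p x by rewrite -scalemxAr.
split.
  under eq_Rintegral do rewrite qE enormZ (ger0_norm (ltW a0)).
  rewrite RintegralZl //; last by case: ip.
  by rewrite (_ : \int[sigma]_x enorm (p x) = N T0) // /a divfK // gt_eqF.
move=> i j.
transitivity (\int[sigma]_x (a * (p x ord0 i * p x ord0 j / enorm (p x)))).
  apply: eq_Rintegral => x _; rewrite qE enormZ (ger0_norm (ltW a0)) !mxE invfM.
  by move: (enorm _)^-1 => e; field; rewrite gt_eqF.
rewrite RintegralZl // -/(m i j); have [->|ij] := eqVneq i j; last by rewrite m_off // mulr0.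
rewrite m_eq /a /=; field; rewrite pnatr_eq0 -lt0n d0; exact: lt0r_neq0.
Qed.
End LewisPosition.

(** * Discretisation by cells of directions *)

Section Discretization.
Context {R : realType} {disp : measure_display} {S : measurableType disp}.
Variable sigma : {measure set S -> \bar R}.
Local Notation rintegrable f := (sigma.-integrable [set: S] (EFin \o f)).

Lemma row_diag_mx_mul n d (w : 'rV[R]_n) (a : 'M[R]_(n, d)) c :
  row c (diag_mx w *m a) = w ord0 c *: row c a.
Proof. by apply/rowP => j; rewrite mul_diag_mx !mxE. Qed.

Lemma weighted_gramE n d (w : 'rV[R]_n) (a : 'M[R]_(n, d)) i j :
  (a^T *m diag_mx w *m a) i j = \sum_c w ord0 c * a c i * a c j.
Proof.
rewrite mul_mx_diag mxE; apply: eq_bigr => c _; rewrite !mxE.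
by rewrite [a c i * _]mulrC.
Qed.

Lemma rintegrable_dominated (f g : S -> R) : measurable_fun [set: S] f ->
  (forall x, `|f x| <= `|g x|) -> rintegrable g -> rintegrable f.
Proof.
move=> mf fg ig; apply: (le_integrable measurableT _ _ ig); first exact/measurable_EFinP.
by move=> x _; rewrite !abse_EFin lee_fin.
Qed.

(** A cell c has weight \int_c |q| and generator \int_c q, so row c of [a] is the mean direction in
    c with respect to |q| dsigma and has norm at most 1. The lower estimate is the triangle
    inequality for the integral. In the others, replacing a direction by the mean of its cell costs
    at most [del] per coordinate, weighted by |q|. *)
Lemma discretization d (q : S -> 'rV[R]_d) (e : R) : 0 < e -> vintegrable sigma q ->
  exists n (w : 'rV[R]_n) (a : 'M[R]_(n, d)),
  [/\ forall c, 0 <= w ord0 c, forall c, enorm (row c a) <= 1,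
    \sum_c w ord0 c = \int[sigma]_x enorm (q x),
    forall z, \sum_c `|dot z (row c (diag_mx w *m a))| <= \int[sigma]_x `|dot (q x) z| <=
      \sum_c `|dot z (row c (diag_mx w *m a))| + e * \sum_l `|z ord0 l| &
    forall i j, `|(a^T *m diag_mx w *m a) i j -
       \int[sigma]_x (q x ord0 i * q x ord0 j / enorm (q x))| <= e].
Proof.
move=> e0 iq; have [mq ir] := iq.
pose r x := enorm (q x); pose u x i := q x ord0 i / r x.
have r0 x : 0 <= r x by exact: enorm_ge0.
have ru x i : r x * u x i = q x ord0 i.
  rewrite /u mulrCA; have [rx0|rx0] := eqVneq (r x) 0; last by rewrite divff ?mulr1.
  rewrite rx0 mul0r mulr0; move/eqP: rx0; rewrite enorm_eq0 => /eqP ->.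
  by rewrite mxE.
have u1 x i : `|u x i| <= 1.
  rewrite /u; have [->|rx0] := eqVneq (r x) 0; first by rewrite invr0 mulr0 normr0.
  rewrite normrM normfV (ger0_norm (r0 x)) ler_pdivrMr ?mul1r ?coord_le_enorm //.
  by rewrite lt_def rx0 r0.
have mr : measurable_fun [set: S] r by exact: vmeasurable_enorm.
have mu i : measurable_fun [set: S] (u ^~ i).
  by apply: measurable_funM => //; exact: (measurableT_comp measurable_invr mr).
pose Z := \int[sigma]_x r x.
have Z0 : 0 <= Z by apply: Rintegral_ge0.
(* The total error is at most del Z <= e; the added 1 covers Z = 0. *)
pose del := e / (Z + 1).
have Z1 : 0 < Z + 1 by rewrite ltr_wpDl.
have del0 : 0 < del by rewrite divr_gt0.
have delZ : del * Z <= e.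
  by rewrite /del mulrAC ler_pdivrMr // ler_wpM2l ?(ltW e0) // lerDl.
(* u + 1 lies in [0, 2], so the first multiple of [del] above it has index at most truncn (2 / del)
   + 1, which must still be an element of ['I_K]. *)
pose K := (Num.truncn (2 / del)).+2.
(* A cell is recorded by the multiples of [del] that are below [u_i + 1]. *)
pose C := {ffun 'I_d * 'I_K -> bool}.
pose cell x : C := [ffun p : 'I_d * 'I_K => p.2%:R * del <= u x p.1 + 1].
(* If the difference exceeded [del], the first multiple of [del] above u_i(x) + 1 would lie below
   u_i(y) + 1 and tell the two cells apart. *)
have cell_le x y i : cell x = cell y -> u y i - u x i <= del.
  move=> cxy; rewrite leNgt; apply/negP => lt_del.
  have ux0 : 0 <= (u x i + 1) / del.
    rewrite divr_ge0 ?(ltW del0) // -lerBlDr sub0r.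
    by move: (u1 x i); rewrite ler_norml => /andP[].
  have mK : ((Num.truncn ((u x i + 1) / del)).+1 < K)%N.
    rewrite /K !ltnS; apply: le_truncn; rewrite ler_pM2r ?invr_gt0 //.
    by move: (u1 x i); rewrite ler_norml => /andP[_]; rewrite -(lerD2r 1).
  have /ffunP/(_ (i, Ordinal mK)) := cxy; rewrite !ffunE /=.
  have /andP[tr1 tr2] := truncn_itv ux0.
  set m := Num.truncn _ in tr1 tr2 *.
  move: tr1 tr2; rewrite ler_pdivlMr // ltr_pdivrMr // => tr1 tr2.
  rewrite leNgt tr2 /= => /esym/negbT/negP; apply.
  by rewrite -natr1 mulrDl mul1r; lra.
have cell_near x y i : cell x = cell y -> `|u x i - u y i| <= del.
  by move=> cxy; rewrite ler_norml lerNl opprB !cell_le.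
pose I (c : C) (x : S) : R := (cell x == c)%:R.
have I01 c x : 0 <= I c x <= 1 by rewrite /I; case: eqP; rewrite ?lexx ?ler01.
have mI c : measurable_fun [set: S] (I c).
  have mA : measurable [set x | cell x = c].
    rewrite (_ : [set x | cell x = c] = \bigcap_(p in [set: 'I_d * 'I_K])
        [set x | (p.2%:R * del <= u x p.1 + 1) = c p]); last first.
      apply/seteqP; split=> [x /= <- p _|x cx] /=; first by rewrite ffunE.
      by apply/ffunP => p; rewrite ffunE; exact: cx.
    apply: fin_bigcap_measurable => // -[i k] _ /=.
    have mu1 : measurable_fun [set: S] (fun x => u x i + 1) by exact: measurable_funD.
    have mge : measurable [set x | k%:R * del <= u x i + 1].
      have := mu1 measurableT _ (measurable_itv `[k%:R * del, +oo[); rewrite setTI.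
      by congr measurable; apply/seteqP; split=> x /=; rewrite in_itv /= andbT.
    case: (c (i, k)) => //.
    rewrite (_ : [set _ | _] = ~` [set x | k%:R * del <= u x i + 1]); first exact: measurableC.
    by apply/seteqP; split=> x /=; [move=> ->|move/negP/negbTE].
  rewrite (_ : I c = \1_[set x | cell x = c]); first exact: measurable_indic.
  by apply/funext => x; rewrite /I indicE; case: eqP => h; [rewrite mem_set|rewrite memNset].
pose J c (f : S -> R) := \int[sigma]_x (I c x * f x).
have mint f : rintegrable f -> measurable_fun [set: S] f.
  by move=> /measurable_int/measurable_EFinP.
have inorm f : rintegrable f -> rintegrable (fun x => `|f x|).
  move=> intf; apply: (rintegrable_dominated _ _ intf) => [|x]; last by rewrite normr_id.
  by apply: measurableT_comp => //; exact: mint.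
have intJ c f : rintegrable f -> rintegrable (fun x => I c x * f x).
  move=> intf; apply: (rintegrable_dominated _ _ intf) => [|x].
    by apply: measurable_funM => //; exact: mint.
  have /andP[I0 I1] := I01 c x.
  by rewrite normrM (ger0_norm I0) ler_piMl.
have sumJ f : rintegrable f -> \sum_c J c f = \int[sigma]_x f x.
  move=> intf; rewrite /J -Rintegral_sum; last by move=> c; exact: intJ.
  apply: eq_Rintegral => x _; rewrite (bigD1 (cell x)) //= big1 ?addr0 => [|c cx].
    by rewrite /I eqxx mul1r.
  by rewrite /I eq_sym (negPf cx) mul0r.
have leJ c f g : rintegrable f -> rintegrable g ->
    (forall x, cell x = c -> f x <= g x) -> J c f <= J c g.
  move=> intf intg fg; apply: le_Rintegral => //; try exact: intJ.
  by move=> x _; rewrite /I; case: eqP => [/fg|_]; rewrite ?mul1r ?mul0r.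
have normJ c f : rintegrable f -> `|J c f| <= J c (fun x => `|f x|).
  move=> intf; apply: le_trans (le_normr_Rintegral measurableT (intJ c f intf)) _.
  apply: le_Rintegral => //; [exact/inorm/intJ|exact/intJ/inorm|move=> x _].
  by have /andP[I0 _] := I01 c x; rewrite normrM (ger0_norm I0).
have JD c f g : rintegrable f -> rintegrable g ->
    J c (fun x => f x + g x) = J c f + J c g.
  move=> intf intg; rewrite /J -RintegralD //; try exact: intJ.
  by apply: eq_Rintegral => x _; rewrite mulrDr.
have JZ c k f : rintegrable f -> J c (fun x => k * f x) = k * J c f.
  move=> intf; rewrite /J -RintegralZl //; last exact: intJ.
  by apply: eq_Rintegral => x _; rewrite mulrCA.
have Jsum c (T : finType) (f : T -> S -> R) : (forall i, rintegrable (f i)) ->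
    J c (fun x => \sum_i f i x) = \sum_i J c (f i).
  move=> intf; rewrite /J -Rintegral_sum; last by move=> i; exact: intJ.
  by apply: eq_Rintegral => x _; rewrite mulr_sumr.
have J0 c f : (forall x, 0 <= f x) -> 0 <= J c f.
  by move=> f0; apply: Rintegral_ge0 => x _; rewrite mulr_ge0 //; case/andP: (I01 c x).
pose rho c := J c r.
have rho0 c : 0 <= rho c by exact: J0.
have intq i : rintegrable (fun x => q x ord0 i).
  by apply: (vintegrable_bounded (C := 1) iq) => // x; rewrite mul1r coord_le_enorm.
pose al c i := J c (fun x => q x ord0 i) / rho c.
(* In a cell of weight zero [al] is 0 by the convention on division, and \int_c q_i vanishes because
   |q_i| <= |q|. *)
have rhoal c i : rho c * al c i = J c (fun x => q x ord0 i).
  rewrite /al mulrCA; have [rc0|rc0] := eqVneq (rho c) 0; last by rewrite divff ?mulr1.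
  rewrite rc0 mul0r mulr0; apply/esym/eqP; rewrite -normr_le0 -rc0.
  apply: le_trans (normJ _ _ (intq i)) _; apply: (leJ c) => //; first exact: inorm.
  by move=> x _; exact: coord_le_enorm.
have intdev j k : rintegrable (fun x => r x * `|u x j - k|).
  apply: (vintegrable_bounded (C := 1 + `|k|) iq) => [|x].
    by apply: measurable_funM => //; apply: measurableT_comp => //; exact: measurable_funB.
  rewrite normrM normr_id (ger0_norm (r0 x)) mulrC ler_wpM2r //.
  by rewrite (le_trans (ler_normB _ _)) // lerD2r.
(* [al c j] is the [r]-weighted mean of u_j over the cell, and u_j varies by at most [del] there. *)
have dev c j : J c (fun x => r x * `|u x j - al c j|) <= del * rho c.
  rewrite -JZ //; have [rc0|rc0] := eqVneq (rho c) 0.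
    have -> : J c (fun x => del * r x) = J c r by rewrite JZ // -/(rho c) rc0 mulr0.
    by apply: (leJ c) => // x _; rewrite /al rc0 invr0 mulr0 subr0 ler_piMr.
  apply: (leJ c) => //; first exact: rintegrableZ.
  move=> x cx; rewrite mulrC ler_wpM2r //.
  have rcp : 0 < rho c by rewrite lt_def rc0 rho0.
  rewrite -(ler_pM2l rcp) -{1}[rho c]ger0_norm // -normrM mulrBr rhoal.
  have -> : rho c * u x j - J c (fun y => q y ord0 j) = J c (fun y => u x j * r y + - 1 * q y ord0 j).
    by rewrite JD ?JZ // ?mulN1r ?[u x j * _]mulrC //; exact: rintegrableZ.
  have intd : rintegrable (fun y => u x j * r y + -1 * q y ord0 j).
    by apply: rintegrableD; exact: rintegrableZ.
  apply: le_trans (normJ _ _ intd) _; rewrite mulrC -JZ //.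
  apply: (leJ c); [exact: inorm|exact: rintegrableZ|move=> y cy].
  rewrite -ru (_ : _ + _ = (u x j - u y j) * r y); last by ring.
  by rewrite normrM (ger0_norm (r0 y)) ler_wpM2r // cell_near // cx cy.
pose p c : 'rV[R]_d := \row_i al c i.
have int_dot z : rintegrable (fun x => dot (q x) z).
  apply: rintegrable_sum => i; under eq_fun do rewrite mulrC; exact: rintegrableZ.
have rho_dot c z : rho c * dot z (p c) = J c (fun x => dot (q x) z).
  rewrite /dot Jsum; last by move=> i; under eq_fun do rewrite mulrC; exact: rintegrableZ.
  rewrite mulr_sumr; apply: eq_bigr => i _; rewrite mxE mulrCA rhoal -JZ //.
  by apply: eq_Rintegral => x _; rewrite [z _ _ * _]mulrC.
(* Pairing [p c] with itself gives rho |p|^2 = \int_c <q, p> <= rho |p|. *)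
have p1 c : enorm (p c) <= 1.
  have [rc0|rc0] := eqVneq (rho c) 0.
    rewrite [p c](_ : _ = 0) ?/enorm ?dot0l ?sqrtr0 //.
    by apply/rowP => i; rewrite !mxE /al rc0 invr0 mulr0.
  have rcp : 0 < rho c by rewrite lt_def rc0 rho0.
  have [pc0|pc0] := eqVneq (enorm (p c)) 0; first by rewrite pc0.
  have pcp : 0 < enorm (p c) by rewrite lt_def pc0 enorm_ge0.
  rewrite -(ler_pM2r pcp) mul1r -expr2 enorm_sqr -(ler_pM2l rcp) rho_dot.
  rewrite [leRHS]mulrC -JZ //; apply: (leJ c) => //; first exact: rintegrableZ.
  by move=> x _; rewrite mulrC (le_trans (ler_norm _)) // dot_le_enorm.
exists #|{: C}|, (\row_k rho (enum_val k)), (\matrix_k p (enum_val k)).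
have sumE (F : C -> R) : \sum_(k < #|{: C}|) F (enum_val k) = \sum_c F c.
  by rewrite [RHS](reindex _ (onW_bij _ (enum_val_bij _))).
set w := \row_k _; set a := \matrix_k _.
have wE k : w ord0 k = rho (enum_val k) by rewrite mxE.
have aE k : row k a = p (enum_val k) by rewrite rowK.
have dotE z : \sum_c `|dot z (row c (diag_mx w *m a))| = \sum_c `|J c (fun x => dot (q x) z)|.
  rewrite -[RHS]sumE; apply: eq_bigr => k _.
  by rewrite row_diag_mx_mul dotZr wE aE rho_dot.
have int_ndot z : rintegrable (fun x => `|dot (q x) z|) by exact/inorm/int_dot.
split.
- by move=> k; rewrite wE.
- by move=> k; rewrite aE.
- by under eq_bigr do rewrite wE; rewrite sumE sumJ.
- move=> z; rewrite dotE -[X in _ <= X <= _]sumJ //; apply/andP; split.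
    by apply: ler_sum => c _; exact: normJ.
  have upper c : J c (fun x => `|dot (q x) z|) <=
      `|J c (fun x => dot (q x) z)| + (\sum_l `|z ord0 l|) * (del * rho c).
    have int_l l : rintegrable (fun x => `|z ord0 l| * (r x * `|u x l - al c l|)).
      exact: rintegrableZ.
    apply: (@le_trans _ _ (J c (fun x => `|dot z (p c)| * r x +
        \sum_l `|z ord0 l| * (r x * `|u x l - al c l|)))).
      apply: (leJ c) => //; first by apply: rintegrableD; [exact: rintegrableZ|exact: rintegrable_sum].
      move=> x _; have -> : dot (q x) z =
          r x * dot z (p c) + \sum_l z ord0 l * (r x * (u x l - al c l)).
        rewrite /dot mulr_sumr -big_split /=; apply: eq_bigr => l _.
        by rewrite -ru mxE; ring.
      rewrite (le_trans (ler_normD _ _)) // lerD //.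
        by rewrite normrM (ger0_norm (r0 x)) mulrC.
      rewrite (le_trans (ler_norm_sum _ _ _)) //; apply: ler_sum => l _.
      by rewrite !normrM (ger0_norm (r0 x)).
    have int1 : rintegrable (fun x => `|dot z (p c)| * r x) by exact: rintegrableZ.
    have int2 : rintegrable (fun x => \sum_l `|z ord0 l| * (r x * `|u x l - al c l|)).
      exact: rintegrable_sum.
    rewrite (JD c _ _ int1 int2) JZ // Jsum //.
    rewrite lerD //.
      by rewrite -rho_dot normrM (ger0_norm (rho0 c)) mulrC.
    rewrite mulr_suml; apply: ler_sum => l _.
    by rewrite JZ // ler_wpM2l.
  apply: le_trans (ler_sum _ (fun c _ => upper c)) _.
  rewrite big_split /= lerD2l -!mulr_sumr sumJ // mulrC ler_wpM2r ?sumr_ge0 //.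
move=> i j; rewrite weighted_gramE.
have int_cov : rintegrable (fun x => q x ord0 i * q x ord0 j / enorm (q x)).
  exact: vintegrable_cov.
have mcov k : measurable_fun [set: S] (fun x => q x ord0 i * (u x j - k)).
  by apply: measurable_funM => //; exact: measurable_funB.
have int_qdev k : rintegrable (fun x => q x ord0 i * (u x j - k)).
  apply: (rintegrable_dominated (mcov k) _ (intdev j k)) => x.
  rewrite -ru normrM (normrM (r x) (u x i)) [leRHS]normrM normr_id (ger0_norm (r0 x)).
  by rewrite ler_wpM2r // ler_piMr.
have -> : \sum_c w ord0 c * a c i * a c j = \sum_c rho c * al c i * al c j.
  by rewrite -[RHS]sumE; apply: eq_bigr => k _; rewrite wE !mxE.
rewrite -[X in _ - X]sumJ // -sumrB.
apply: le_trans (ler_norm_sum _ _ _) _.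
apply: (@le_trans _ _ (\sum_c del * rho c)); last by rewrite -mulr_sumr sumJ.
(* As q_j / |q| = u_j, the difference in cell c is - \int_c q_i (u_j - al_j), which [dev] controls
   because |q_i| <= |q|. *)
apply: ler_sum => c _; rewrite rhoal.
have -> : J c (fun x => q x ord0 i) * al c j - J c (fun x => q x ord0 i * q x ord0 j / enorm (q x)) =
    - J c (fun x => q x ord0 i * (u x j - al c j)).
  rewrite [J c (fun x => q x ord0 i * (_ - _))](_ : _ =
      J c (fun x => q x ord0 i * q x ord0 j / enorm (q x) + - al c j * q x ord0 i)).
    by rewrite JD ?JZ //; [ring|exact: rintegrableZ].
  by apply: eq_Rintegral => x _; rewrite /u /r; congr (_ * _); ring.
rewrite normrN (le_trans (normJ _ _ (int_qdev _))) // (le_trans _ (dev c j)) //.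
apply: (leJ c) => //; first exact: inorm.
move=> x _; rewrite -ru normrM (normrM (r x) (u x i)) (ger0_norm (r0 x)).
by rewrite ler_wpM2r // ler_piMr.
Qed.
End Discretization.

(** * Volume bounds *)

Section Subspaces.
Context {R : realType}.

Lemma orthomx_direct d (E : 'M[R]_d) :
  let F := orthomx idfun 1%:M E in (E :&: F = 0)%MS /\ ((1%:M : 'M[R]_d) <= E + F)%MS.
Proof.
move=> F.
have FE m (u : 'M[R]_(m, d)) : (u <= F)%MS -> u *m E^T = 0.
  by move/sub_kermxP; rewrite mul1mx map_mx_id.
have EF : (E :&: F = 0)%MS.
  apply/eqP/rowV0P => u; rewrite sub_capmx => /andP[/submxP[c uE] /FE uF].
  apply/eqP; rewrite -dotxx_eq0 dotE {2}uE trmx_mul mulmxA uF mul0mx mxE //.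
split=> //; rewrite sub1mx -col_leq_rank.
have := mxrank_disjoint_sum EF => ->.
by rewrite /F mxrank_ker mul1mx map_mx_id // mxrank_tr addnC subnK // rank_leq_col.
Qed.

Lemma ortho_proj_coords d k (E : 'M[R]_d) (B : 'M[R]_(k, d)) x : (B <= E)%MS ->
  ortho_proj E x *m B^T = x *m B^T.
Proof.
move=> BE; have [EF sEF] := orthomx_direct E.
set F := orthomx idfun 1%:M E in EF sEF.
have xEF : (x <= E + F)%MS by rewrite (submx_trans (submx1 x)).
rewrite -[in RHS](add_proj_mx EF xEF) mulmxDl -/F.
have -> : x *m proj_mx F E *m B^T = 0.
  have /submxP[D ->] := BE; rewrite trmx_mul mulmxA.
  have /sub_kermxP := proj_mx_sub F E x; rewrite mul1mx map_mx_id // => ->.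
  by rewrite mul0mx.
by rewrite addr0.
Qed.

(** The determinant of a compression depends only on the subspace: the two bases differ by an
    orthogonal matrix [X], and \det X enters squared. *)
Lemma det_orthonormal_rows d k (B C : 'M[R]_(k, d)) (G : 'M[R]_d) :
  B *m B^T = 1%:M -> C *m C^T = 1%:M -> (B <= C)%MS ->
  \det (B *m G *m B^T) = \det (C *m G *m C^T).
Proof.
move=> BB CC /submxP[X BE].
have XX : X *m X^T = 1%:M by rewrite -BB BE trmx_mul mulmxA -(mulmxA X) CC mulmx1.
have -> : B *m G *m B^T = X *m (C *m G *m C^T) *m X^T by rewrite BE trmx_mul !mulmxA.
by rewrite !det_mulmx mulrAC -det_mulmx XX det1 mul1r.
Qed.

Lemma span_rowsub d (W : 'M[R]_d) (s : {set 'I_d}) :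
  (span_of (fun i => row i W) s :=: rowsub (@enum_val _ (mem s)) W)%MS.
Proof.
apply/eqmxP/andP; split.
  apply/sumsmx_subP => i si; rewrite genmxE.
  rewrite (_ : row i W = row (enum_rank_in si i) (rowsub (@enum_val _ (mem s)) W)).
    exact: row_sub.
  by rewrite row_rowsub enum_rankK_in.
apply/row_subP => i; rewrite row_rowsub.
apply: (sumsmx_sup (enum_val i)); first exact: enum_valP.
by rewrite genmxE.
Qed.

Lemma rowsub_orthonormal d (W : 'M[R]_d) (s : {set 'I_d}) : W *m W^T = 1%:M ->
  let C := rowsub (@enum_val _ (mem s)) W in C *m C^T = 1%:M.
Proof.
move=> WW C; apply/matrixP => i j.
have /matrixP/(_ (enum_val i) (enum_val j)) := WW.
rewrite !mxE (inj_eq enum_val_inj) => <-.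
by apply: eq_bigr => k _; rewrite !mxE.
Qed.

(** [subspace_volume] uses an orthonormal basis picked by choice, with \rank E rows. Here it becomes
    some [B] with #|s| rows, and the projection disappears because coordinates in a basis of E
    ignore the orthogonal complement. *)
Lemma subspace_volume_span d (W : 'M[R]_d) (s : {set 'I_d}) (K : set 'rV[R]_d) :
  W *m W^T = 1%:M ->
  let E := span_of (fun i => row i W) s in
  exists B : 'M[R]_(#|s|, d), [/\ B *m B^T = 1%:M,
    (B :=: rowsub (@enum_val _ (mem s)) W)%MS &
    subspace_volume E [set ortho_proj E x | x in K] = volume [set x *m B^T | x in K]].
Proof.
move=> WW E; set C := rowsub _ W.
have CC : C *m C^T = 1%:M by exact: rowsub_orthonormal.
have EC : (E :=: C)%MS by exact: span_rowsub.
have rE : \rank E = #|s|.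
  by rewrite EC; apply/eqP/row_freeP; exists C^T.
have [B0 [B0B0 B0E]] : exists B : 'M[R]_(\rank E, d), B *m B^T = 1%:M /\ (B :=: E)%MS.
  by rewrite rE; exists C; split=> //; exact: eqmx_sym.
rewrite /subspace_volume.
have [BB BE] : is_onb_of (xget 0 (@is_onb_of R d E)).
  by apply: (@xgetPex _ 0 (@is_onb_of R d E)); exists B0; split=> //; exact/eqmxP.
move: (xget 0 _) BB BE; move: (\rank E) rE => k -> B BB /eqmxP BE.
exists B; split=> //; first exact: eqmx_trans BE EC.
congr volume; apply/seteqP; split=> [_ [_ [x Kx <-] <-]|_ [x Kx <-]].
  by exists x => //; rewrite ortho_proj_coords // BE.
by exists (ortho_proj E x); [exists x|rewrite ortho_proj_coords // BE].
Qed.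

Lemma det_rowsub_diag d (D : 'M[R]_d) (W G : 'M[R]_d) (s : {set 'I_d}) :
  D = W *m G *m W^T -> is_diag_mx D ->
  let C := rowsub (@enum_val _ (mem s)) W in
  \det (C *m G *m C^T) = \prod_(i in s) D i i.
Proof.
move=> DE /is_diag_mxP Ddiag C.
have CE i j : (C *m G *m C^T) i j = D (enum_val i) (enum_val j).
  rewrite DE -mulmxA mul_rowsub_mx -[in RHS]mulmxA !mxE.
  apply: eq_bigr => k _; rewrite mxE; congr (_ * _).
  by rewrite !mxE; apply: eq_bigr => l _; rewrite !mxE.
rewrite det_trig.
  by rewrite [RHS]big_enum_val; apply: eq_bigr => i _; rewrite CE.
apply/is_trig_mxP => i j ij; rewrite CE Ddiag //.
by apply: contraTneq ij => /val_inj/enum_val_inj ->; rewrite ltnn.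
Qed.
End Subspaces.

(** * Zonotope bounds and their limits *)

Section Bounds.
Context {R : realType}.

(** The passage to the limit in both volume bounds: [M] is a Gram matrix of a discretisation,
    possibly corrected, and isotropy places it near the identity. *)
Lemma le_continuous_at1 d (Phi : 'M[R]_d -> R) (x : R) : continuous Phi ->
  (forall e, 0 < e -> exists2 M : 'M[R]_d, (forall i j, `|M i j - (i == j)%:R| <= e) & x <= Phi M) ->
  x <= Phi 1%:M.
Proof.
move=> cPhi approx; rewrite leNgt; apply/negP => lt1.
have op : open [set y : R | y < x] by exact: open_lt.
have /nbhs_ballP[e /= e0 sub] : nbhs (1%:M : 'M[R]_d) (Phi @^-1` [set y | y < x]).
  by apply: (cPhi 1%:M); apply: open_nbhs_nbhs.
have e2 : 0 < e / 2 by rewrite divr_gt0.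
have [M M1 xM] := approx _ e2.
have : Phi M < x.
  apply: sub; split=> // i j; rewrite -ball_normE /= mxE distrC.
  by rewrite (le_lt_trans (M1 i j)) // ltr_pdivrMr // ltr_pMr // ltr1n.
by rewrite ltNge xM.
Qed.

Lemma continuous_mulmxl m n p (a : 'M[R]_(m, n)) :
  continuous (fun x : 'M[R]_(n, p) => a *m x).
Proof.
apply: continuous_coords => i j.
rewrite (_ : (fun x => _) = (fun x : 'M[R]_(n, p) => \sum_k a i k * x k j)).
  apply: continuous_sumr => k; apply: continuous_mul2; first exact: cst_continuous.
  exact: continuous_entry.
by apply/funext => x; rewrite mxE.
Qed.

Lemma zonotope_sub d n (a : 'M[R]_(n, d)) (K : set 'rV[R]_d) : compact K ->
  (forall x y p, 0 <= p <= 1 -> K x -> K y -> K (p *: x + (1 - p) *: y)) ->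
  (forall y, exists2 x, K x & \sum_c `|dot y (row c a)| <= dot y x) ->
  zonotope a `<=` K.
Proof.
move=> cK cvK sup z Zz; apply: convex_separation => // y.
by have [x Kx xy] := sup y; exists x => //; rewrite (le_trans (zonotope_support_le y Zz)).
Qed.

Lemma sub_zonotope d n (a : 'M[R]_(n, d)) (K : set 'rV[R]_d) :
  (forall x y, K x -> dot y x <= \sum_c `|dot y (row c a)|) -> K `<=` zonotope a.
Proof.
move=> sup x Kx; apply: convex_separation; first exact: compact_zonotope.
  by move=> ? ? ?; exact: zonotope_convex.
move=> y; have [z Zz zE] := zonotope_support_eq a y.
by exists z => //; rewrite zE sup.
Qed.

Lemma compact_image_mulmx d k (K : set 'rV[R]_d) (M : 'M[R]_(d, k)) : compact K ->
  compact [set x *m M | x in K].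
Proof.
by apply: continuous_compact; apply: continuous_subspaceT; exact: continuous_mulmxr.
Qed.

(** A Householder matrix turns the normal [c] into the first axis, where every fibre is at most a
    point. *)
Lemma volume_hyperplane k (L : set 'rV[R]_k) (c : 'rV[R]_k) : compact L -> c != 0 ->
  (forall z, L z -> dot z c = 0) -> volume L = 0%E.
Proof.
case: k L c => [|k] L c cL c0 Lc; first by rewrite thinmx0 eqxx in c0.
have [P PP cP] := householder c.
have uP : P^T \in unitmx by rewrite unitmx_tr; case/mulmx1_unit: PP.
have mL := rmeasurable_compact cL.
rewrite (volume_linear uP mL) (@volume_coord0 _ _ [set x | L (x *m P^T)]) ?mule0 //.
  have := rmeasurable_affine P^T 0 mL; congr rmeasurable.
  by apply/seteqP; split=> x /=; rewrite addr0.
move=> x /Lc; rewrite dot_mulmx trmxK cP dotZr => /eqP.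
rewrite mulf_eq0 enorm_eq0 (negPf c0) /= => /eqP <-.
rewrite /dot (bigD1 ord0) //= big1 ?addr0 => [|i i0]; rewrite !mxE eqxx /=.
  by rewrite mulr1.
by rewrite (negPf i0) mulr0.
Qed.

Lemma dot_row_mulmx n d k (a : 'M[R]_(n, d)) (M : 'M[R]_(d, k)) c y :
  dot y (row c (a *m M)) = dot (y *m M^T) (row c a).
Proof. by rewrite row_mul dotC dot_mulmx dotC. Qed.

Context {disp : measure_display} {S : measurableType disp}.
Variable sigma : {measure set S -> \bar R}.

Section lewis.
Variables (d : nat) (v : S -> 'rV[R]_d) (T : 'M[R]_d) (K : set 'rV[R]_d).
Hypotheses (uT : T \in unitmx) (iv : vintegrable sigma v).
Let q x := v x *m T.
Hypothesis q_int : \int[sigma]_x enorm (q x) = d%:R.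
Hypothesis q_iso : forall i j,
  \int[sigma]_x (q x ord0 i * q x ord0 j / enorm (q x)) = (i == j)%:R.
Hypothesis cK : compact K.
Let A := invmx T.
Let G := A^T *m A.

Let iq : vintegrable sigma q. Proof. exact: vintegrable_mulmx. Qed.

Let dot_vq x y : dot (v x) y = dot (q x) (y *m A^T).
Proof. by rewrite -dot_mulmx /q mulmxK. Qed.

(** Since v = q A, the zonotope of the discretised q, mapped by A, has a support function below that
    of [K] and so lies in [K]. The 1 / d! in its volume cancels the d! of [detsum_ge]. *)
Lemma lewis_volume_ge :
  (forall x y p, 0 <= p <= 1 -> K x -> K y -> K (p *: x + (1 - p) *: y)) ->
  (forall y, exists2 x, K x & \int[sigma]_x `|dot (v x) y| <= dot y x) ->
  ((2 ^+ d * `|\det A|)%:E <= volume K)%E.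
Proof.
move=> cvK sup; have mK := rmeasurable_compact cK.
have := volume_ge0 K; case volK : (volume K) => [r| |] //= _; last by rewrite leey.
rewrite lee_fin.
pose Phi (M : 'M[R]_d) := r - 2 ^+ d * `|\det A| * \det M.
suff : 0 <= Phi 1%:M by rewrite /Phi det1 mulr1 subr_ge0.
have cPhi : continuous Phi.
  have cdet := @continuous_mul2 R _ _ _ (@cst_continuous _ _ (2 ^+ d * `|\det A|)) (@continuous_det R d).
  by move=> x; exact: (cvgB (@cst_continuous _ _ r x) (cdet x)).
apply: le_continuous_at1 => // e e0.
have [n [w [a [w0 a1 sw Zle Mle]]]] := discretization e0 iq.
exists (a^T *m diag_mx w *m a); first by move=> i j; rewrite -q_iso Mle.
rewrite subr_ge0 -lee_fin -volK.
have ZK : zonotope (diag_mx w *m a *m A) `<=` K.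
  apply: zonotope_sub => // y; have [x Kx xy] := sup y; exists x => //.
  apply: le_trans xy; under eq_bigr do rewrite dot_row_mulmx.
  under eq_Rintegral do rewrite dot_vq.
  by have /andP[] := Zle (y *m A^T).
apply: le_trans (le_volume _ mK ZK); last by apply: rmeasurable_compact; exact: compact_zonotope.
rewrite volume_zonotope lee_fin detsumM -!mulrA ler_wpM2l ?exprn_ge0 //.
rewrite mulrCA ler_wpM2l // mulrC -ler_pdivrMr ?invr_gt0 ?ltr0n ?fact_gt0 //.
by rewrite invrK mulrC; exact: detsum_ge.
Qed.

(** In coordinates the projection has support function y -> h_K(y B), and y B pairs with v as y B
    A^T pairs with q. A discretisation of q enlarged by small axis-parallel generators therefore
    gives a zonotope that contains it, to which [detsum_le] applies. *)
Lemma lewis_volume_le k (B : 'M[R]_(k, d)) :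
  (forall x y, K x -> dot y x <= \int[sigma]_x `|dot (v x) y|) ->
  (volume [set x *m B^T | x in K] <=
   (2 ^+ k / Num.sqrt k`!%:R * Num.sqrt d%:R ^+ k * Num.sqrt (\det (B *m G *m B^T)))%:E)%E.
Proof.
move=> sup; have cL := @compact_image_mulmx _ _ _ B^T cK.
set L := [set _ | _ in _] in cL *; have mL := rmeasurable_compact cL.
pose Phi (M : 'M[R]_d) : R := (2 ^+ k / k`!%:R) ^+ 2 * k`!%:R * d%:R ^+ k *
  \det (B *m A^T *m M *m (A *m B^T)).
have cPhi : continuous Phi.
  apply: continuous_mul2; first exact: cst_continuous.
  have c1 := @continuous_mulmxl _ _ d (B *m A^T).
  have c2 := @continuous_mulmxr R k _ _ (A *m B^T).
  move=> M; apply: (continuous_comp (f := fun M => B *m A^T *m M *m (A *m B^T))).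
    exact: (continuous_comp (c1 M) (c2 _)).
  exact: continuous_det.
(* The new Gram matrix is (1 + e)(M + e) for the old M. It differs from the identity by (1 + e)(M -
   1) + 2 e + e^2, whose entries are at most 2 e + 3 e for e <= 1. *)
have upper e : 0 < e -> e <= 1 -> exists2 M : 'M[R]_d,
    (forall i j, `|M i j - (i == j)%:R| <= 5 * e) &
    exists z, [/\ 0 <= z, (volume L <= z%:E)%E & z ^+ 2 <= Phi M].
  move=> e0 e1.
  have [n [w [a [w0 a1 sw Zle Mle]]]] := discretization e0 iq.
  (* The extra generators [e * e_l] absorb the discretisation error. *)
  pose w' : 'rV[R]_(n + d) := row_mx w (const_mx e).
  pose a' : 'M[R]_(n + d, d) := col_mx a 1%:M.
  have w'0 c : 0 <= w' ord0 c.
    by case: (split_ordP c) => i ->; rewrite ?row_mxEl ?row_mxEr // mxE ltW.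
  have sw' : \sum_c w' ord0 c = d%:R * (1 + e).
    rewrite big_split_ord /= (eq_bigr (fun c => w ord0 c)) => [|c _]; last by rewrite row_mxEl.
    rewrite sw q_int (eq_bigr (fun=> e)) => [|c _]; last by rewrite row_mxEr mxE.
    by rewrite sumr_const card_ord mulrDr mulr1 mulr_natl.
  set M := a^T *m diag_mx w *m a in Mle.
  have gram' : a'^T *m diag_mx w' *m a' = M + e%:M.
    apply/matrixP => i j; rewrite [RHS]mxE !weighted_gramE big_split_ord /=; congr (_ + _).
      by apply: eq_bigr => c _; rewrite row_mxEl !col_mxEu.
    rewrite (bigD1 i) //= big1 ?addr0 => [|l li].
      by rewrite row_mxEr !col_mxEd !mxE eqxx mulr1 mulr_natr.
    by rewrite row_mxEr !col_mxEd !mxE (negPf li) mulr0 mul0r.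
  have LZ : L `<=` zonotope (diag_mx w' *m (a' *m (A *m B^T))).
    apply: sub_zonotope => _ y [x Kx <-].
    rewrite dotC dot_mulmx trmxK dotC; apply: le_trans (sup x (y *m B) Kx) _.
    under eq_Rintegral do rewrite dot_vq.
    set Y := y *m B *m A^T.
    have YE : y *m (A *m B^T)^T = Y by rewrite trmx_mul trmxK mulmxA.
    have /andP[_] := Zle Y => /le_trans; apply.
    rewrite mulmxA; under [leRHS]eq_bigr do rewrite dot_row_mulmx YE.
    rewrite big_split_ord /= lerD //.
      apply: ler_sum => c _; rewrite !row_diag_mx_mul row_mxEl.
      by rewrite (_ : row _ a' = row c a) //; apply/rowP => j; rewrite mxE col_mxEu [RHS]mxE.
    rewrite mulr_sumr; apply: ler_sum => l _; rewrite row_diag_mx_mul row_mxEr [const_mx _ _ _]mxE dotZr.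
    rewrite normrM (ger0_norm (ltW e0)) ler_wpM2l ?(ltW e0) //.
    have -> : row (rshift n l) a' = delta_mx ord0 l.
      by apply/rowP => j; rewrite mxE col_mxEd !mxE eqxx eq_sym.
    rewrite /dot (bigD1 l) //= big1 ?addr0 => [|j jl]; rewrite !mxE eqxx /=.
      by rewrite eqxx mulr1.
    by rewrite (negPf jl) mulr0.
  pose z := 2 ^+ k / k`!%:R * detsum (diag_mx w' *m (a' *m (A *m B^T))).
  have dn0 : 0 <= (2 ^+ k / k`!%:R : R) by rewrite divr_ge0 // exprn_ge0.
  (* The enlarged weights sum to d (1 + e); the excess (1 + e)^k is absorbed into the k-dimensional
     determinant by scaling the Gram matrix. *)
  exists ((1 + e) *: (M + e%:M)).
    move=> i j; have := Mle i j; rewrite q_iso.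
    have -> : ((1 + e) *: (M + e%:M)) i j = (1 + e) * (M i j + e *+ (i == j)).
      by rewrite mxE; congr (_ * _); rewrite mxE; congr (_ + _); rewrite mxE.
    move: (M i j) => X.
    have p0 : 0 <= 1 + e by rewrite addr_ge0 // ltW.
    have ee : e * e <= e by rewrite ler_piMl // ltW.
    rewrite !ler_norml => /andP[/(ler_wpM2l p0) h1 /(ler_wpM2l p0) h2].
    by apply/andP; move: h1 h2; case: (i == j) => /=; rewrite ?mulr1n ?mulr0n; split; lra.
  exists z; split.
  - by rewrite mulr_ge0 // detsum_ge0.
  - rewrite -volume_zonotope; apply: le_volume => //.
    by apply: rmeasurable_compact; exact: compact_zonotope.
  - have -> : z ^+ 2 = (2 ^+ k / k`!%:R) ^+ 2 *
        detsum (diag_mx w' *m (a' *m (A *m B^T))) ^+ 2 by rewrite /z exprMn.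
    rewrite /Phi -[_ * k`!%:R * _ * _]mulrA -[_ * k`!%:R * _]mulrA ler_wpM2l ?sqr_ge0 //.
    apply: le_trans (detsum_le _ w'0) _.
    rewrite sw' exprMn trmx_mul.
    rewrite (_ : _ *m _ *m diag_mx w' *m _ = (A *m B^T)^T *m (M + e%:M) *m (A *m B^T)); last first.
      by rewrite -gram' !mulmxA.
    rewrite trmx_mul trmxK -scalemxAr -scalemxAl detZ.
    by rewrite -!mulrA le_eqVlt; apply/orP; left; apply/eqP; ring.
(* A single instance of [upper] shows that the volume is finite, so that it can be squared as a real
   number. *)
have [z1 z1L] : exists z1 : R, (volume L <= z1%:E)%E.
  by have [M _ [z [_ Lz _]]] := upper 1 ltr01 (lexx _); exists z.
have := volume_ge0 L; case volL : (volume L) z1L => [l| |] //= _; rewrite !lee_fin => l0.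
have l2 : l ^+ 2 <= Phi 1%:M.
  apply: le_continuous_at1 => // e e0.
  have e5 : 0 < Num.min 1 (e / 5) by rewrite lt_min ltr01 divr_gt0.
  have [|M Mle [z [z0 Lz zPhi]]] := upper _ e5; first by rewrite ge_min lexx.
  exists M => [i j|].
    by rewrite (le_trans (Mle i j)) // mulrC -ler_pdivlMr // ge_min lexx orbT.
  rewrite (le_trans _ zPhi) // ler_pXn2r // ?nnegrE //.
  by move: Lz; rewrite volL lee_fin.
rewrite -[l]ger0_norm // -sqrtr_sqr.
apply: le_trans (ler_wsqrtr l2) _.
have f0 : 0 < k`!%:R :> R by rewrite ltr0n fact_gt0.
rewrite /Phi mulmx1 (_ : B *m A^T *m (A *m B^T) = B *m G *m B^T); last by rewrite /G !mulmxA.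
have -> : (2 ^+ k / k`!%:R) ^+ 2 * k`!%:R * d%:R ^+ k =
    (2 ^+ k / Num.sqrt k`!%:R * Num.sqrt d%:R ^+ k) ^+ 2 :> R.
  set s := Num.sqrt k`!%:R; set t := Num.sqrt d%:R.
  have sE : k`!%:R = s ^+ 2 by rewrite sqr_sqrtr // ltW.
  have tE : d%:R = t ^+ 2 by rewrite sqr_sqrtr.
  have s0 : s != 0 by rewrite gt_eqF // sqrtr_gt0.
  rewrite sE tE exprAC; move: s t (t ^+ k) (2 ^+ k) s0 {sE tE} => s t x y s0.
  by field.
by rewrite sqrtrM ?sqr_ge0 // sqrtr_sqr ger0_norm.
Qed.
End lewis.
End Bounds.

(** * Measurability, convexity, and products over a cover *)

Section MainLemmas.
Context {R : realType}.

Lemma borel_measurable_vmeasurable {disp : measure_display} {S : measurableType disp}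
    d (v : S -> 'rV[R]_d) : borel_measurable v -> vmeasurable v.
Proof.
move=> mv i; apply: (measurability _ (RGenOpens.measurableE R)).
move=> _ [_ [a [b ->] <-]]; rewrite setTI.
have oU : open ((fun x : 'rV[R]_d => x ord0 i) @^-1` `]a, b[%classic).
  have /continuousP ci := @continuous_entry R 1 d ord0 i.
  by apply: ci; exact: interval_open.
have mU : measurable ((fun x : 'rV[R]_d => x ord0 i) @^-1` `]a, b[%classic
    : set (g_sigma_algebraType (@open 'rV[R]_d))) by exact: sub_sigma_algebra.
by have := mv measurableT _ mU; rewrite setTI.
Qed.

Lemma convex_set_segment d (K : set 'rV[R]_d) : convex_set K ->
  forall x y p, 0 <= p <= 1 -> K x -> K y -> K (p *: x + (1 - p) *: y).
Proof.
move=> cK x y p /andP[p0 p1] Kx Ky.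
exact/set_mem/(cK x y (Itv01 p0 p1) (mem_set Kx) (mem_set Ky)).
Qed.

Lemma orthonormal_basis_rows d (W : 'M[R]_d) : W *m W^T = 1%:M ->
  orthonormal_basis (fun i => row i W).
Proof.
move=> WW; split.
  move=> i j; have /matrixP/(_ i j) := WW; rewrite !mxE => <-.
  by apply: eq_bigr => k _; rewrite !mxE.
apply/eqmxP/(eqmx_trans _ (_ : (W :=: 1%:M)%MS)).
  apply/eqmxP/andP; split; first by apply/sumsmx_subP => i _; rewrite genmxE row_sub.
  by apply/row_subP => i; apply: (sumsmx_sup i) => //; rewrite genmxE.
by apply/eqmxP; rewrite submx1 sub1mx row_full_unit; case/mulmx1_unit: WW.
Qed.

Lemma prod_cover d (F : 'I_d -> R) m (s : 'I_m -> {set 'I_d}) :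
  one_uniform_cover s -> \prod_j \prod_(i in s j) F i = \prod_i F i.
Proof.
move=> [_ cov].
rewrite (exchange_big_dep xpredT) //=; apply: eq_bigr => i _.
have [j [ij uj]] := cov i.
rewrite (bigD1 j) //= big1 ?mulr1 // => k /andP[ik kj].
by rewrite -(uj k ik) eqxx in kj.
Qed.
Lemma big_ereal_prod_le m (a : 'I_m -> \bar R) (b : 'I_m -> R) :
  (forall j, 0 <= a j <= (b j)%:E)%E -> (\prod_j a j <= (\prod_j b j)%:E)%E.
Proof.
move=> ab; suff /andP[] : (0 <= \prod_j a j <= (\prod_j b j)%:E)%E by [].
apply: (big_ind2 (fun x y => (0 <= x <= y%:E)%E)) => [|x1 y1 x2 y2|//].
  by rewrite lexx lee_fin ler01.
move=> /andP[x10 xy1] /andP[x20 xy2].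
by rewrite mule_ge0 //= EFinM lee_pmul.
Qed.
End MainLemmas.

Lemma sqrt_prod (R : realType) (I : finType) (P : pred I) (g : I -> R) :
  (forall i, 0 <= g i) ->
  Num.sqrt (\prod_(i | P i) g i) = \prod_(i | P i) Num.sqrt (g i).
Proof.
move=> g0; elim/big_rec2 : _ => [|i y x _ <-]; first by rewrite sqrtr1.
by rewrite sqrtrM.
Qed.

Theorem theorem5p8 (R : realType) (d : nat) (d_gt0 : (0 < d)%N)
    (disp : measure_display) (S : measurableType disp)
    (sigma : {sigma_finite_measure set S -> \bar R})
    (v : S -> 'rV[R]_d) (v_meas : borel_measurable v)
    (v_int : (\int[sigma]_(x in [set: S]) (enorm (v x))%:E < +oo)%E)
    (K : set 'rV[R]_d) (K_Pi : is_Pi sigma v K) :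
  exists w : 'I_d -> 'rV[R]_d,
    orthonormal_basis w /\
    forall (m : nat) (s : 'I_m -> {set 'I_d}),
      one_uniform_cover s ->
      (\prod_(j < m) subspace_volume (span_of w (s j))
                       [set ortho_proj (span_of w (s j)) x | x in K] <=
       (Num.sqrt d%:R ^+ d / \prod_(j < m) Num.sqrt ((#|s j|)`!)%:R)%R%:E *
         volume K)%E.
Proof.
have mv := borel_measurable_vmeasurable v_meas.
have iv : vintegrable sigma v.
  split=> //; apply/integrableP; split.
    by apply/measurable_EFinP; exact: vmeasurable_enorm.
  by under eq_integral do rewrite abse_EFin (ger0_norm (enorm_ge0 _)).
have [cK /convex_set_segment cvK suppK] := K_Pi.
have suppE y : support_function K y = (\int[sigma]_x `|dot (v x) y|)%:E.
  rewrite suppK /Rintegral fineK; last exact: integrable_fin_num (vintegrable_dot y iv).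
  by apply: eq_integral => x _; rewrite dotC.
have sup_le x y : K x -> dot y x <= \int[sigma]_z `|dot (v z) y|.
  by move=> Kx; rewrite -lee_fin -suppE; apply: ereal_sup_ubound; exists x.
(* The supremum is attained by compactness; [K] is non-empty because its support function is finite,
   whereas the supremum of the empty set is -oo. *)
have sup_ge y : exists2 x, K x & \int[sigma]_z `|dot (v z) y| <= dot y x.
  have K0 : K !=set0.
    apply/set0P/eqP => K0; have := suppE 0.
    by rewrite /support_function K0 image_set0 ereal_sup0.
  have cy : continuous (fun x : 'rV[R]_d => dot y x).
    apply: continuous_sumr => i; apply: continuous_mul2; first exact: cst_continuous.
    exact: continuous_entry.
  have [x /set_mem Kx xmax] := compact_EVT_max K0 cK (continuous_subspaceT cy).
  exists x => //; rewrite -lee_fin -suppE; apply: ge_ereal_sup => _ [z Kz <-].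
  by rewrite lee_fin xmax //; exact/mem_set.
have const_ge0 m (s : 'I_m -> {set 'I_d}) :
    0 <= Num.sqrt d%:R ^+ d / \prod_(j < m) Num.sqrt ((#|s j|)`!)%:R :> R.
  by rewrite divr_ge0 ?exprn_ge0 ?sqrtr_ge0 // prodr_ge0 // => j _; exact: sqrtr_ge0.
have [[y y0 hy]|nondeg] := pselect (exists2 y, y != 0 & \int[sigma]_z `|dot (v z) y| = 0).
  case: d d_gt0 v v_meas v_int K K_Pi mv iv cK cvK suppK suppE sup_le sup_ge const_ge0 y y0 hy => // d' _.
  move=> v v_meas v_int K K_Pi mv iv cK cvK suppK suppE sup_le sup_ge const_ge0 y y0 hy.
  have [P PP yP] := householder y.
  have WW : P^T *m P^T^T = 1%:M by rewrite trmxK; exact: mulmx1C.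
  exists (fun i => row i P^T); split; first exact: orthonormal_basis_rows.
  move=> m s cov; have [j [j0 _]] := cov.2 ord0.
  rewrite (bigD1 j) //=.
  have [B [BB BE ->]] := subspace_volume_span (s j) K WW.
  (* The normal [y] is |y| times the first basis vector and so lies in the subspace. Its coordinates
     y B^T are then a non-zero normal of the projected body. *)
  have yBB : y *m B^T *m B = y.
    suff /submxP[D ->] : (y <= B)%MS by rewrite -(mulmxA D) BB mulmx1.
    have -> : y = enorm y *: row ord0 P^T.
      by rewrite rowE scalemxAl -yP -mulmxA PP mulmx1.
    rewrite scalemx_sub // BE.
    rewrite -[ord0](enum_rankK_in j0 j0) -row_rowsub; exact: row_sub.
  rewrite (@volume_hyperplane _ _ _ (y *m B^T)) ?mul0e.
  - by apply: mule_ge0; [rewrite lee_fin; exact: const_ge0|exact: volume_ge0].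
  - exact: compact_image_mulmx.
  - by apply: contra y0 => /eqP yB0; rewrite -yBB yB0 mul0mx.
  move=> _ [x Kx <-]; rewrite dot_mulmx trmxK yBB dotC; apply/eqP.
  have le1 := sup_le x y Kx; have := sup_le x (- y) Kx.
  have -> : \int[sigma]_z `|dot (v z) (- y)| = \int[sigma]_z `|dot (v z) y|.
    by apply: eq_Rintegral => z _; rewrite dotNr normrN.
  by move: le1; rewrite dotNl hy oppr_le0 eq_le => -> ->.
(* From here on, [v] is not almost everywhere in a hyperplane and Lewis' position exists. *)
have pos y : y != 0 -> 0 < \int[sigma]_z `|dot (v z) y|.
  move=> y0; rewrite lt_def Rintegral_ge0 // andbT.
  by apply/eqP => hy; apply: nondeg; exists y.
have [T uT [q_int q_iso]] := lewis_position d_gt0 iv pos.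
pose A := invmx T; pose G := A^T *m A.
have GT : G^T = G by rewrite /G trmx_mul trmxK.
have [W WW Wdiag] := symmetric_diagonalization GT.
exists (fun i => row i W); split; first exact: orthonormal_basis_rows.
move=> m s cov.
pose g i := (W *m G *m W^T) i i.
have bound j : (0 <= subspace_volume (span_of (fun i => row i W) (s j))
    [set ortho_proj (span_of (fun i => row i W) (s j)) x | x in K] <=
    (2 ^+ #|s j| / Num.sqrt (#|s j|)`!%:R * Num.sqrt d%:R ^+ #|s j| *
      Num.sqrt (\prod_(i in s j) g i))%:E)%E.
  have [B [BB BE ->]] := subspace_volume_span (s j) K WW.
  rewrite volume_ge0 /=.
  have := lewis_volume_le uT iv q_int q_iso cK B sup_le.
  rewrite (det_orthonormal_rows _ BB (rowsub_orthonormal (s j) WW)) ?BE //.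
  by rewrite (det_rowsub_diag (s j) erefl Wdiag).
apply: le_trans (big_ereal_prod_le bound) _.
have lower := lewis_volume_ge uT iv q_iso cK cvK sup_ge.
rewrite -/A in lower.
apply: le_trans (lee_wpmul2l _ lower); last by rewrite lee_fin const_ge0.
rewrite -EFinM lee_fin.
have g0 i : 0 <= g i.
  have -> : g i = dot (row i (W *m A^T)) (row i (W *m A^T)).
    rewrite /g /G mulmxA -(mulmxA (W *m A^T)) mxE; apply: eq_bigr => k _.
    by rewrite !mxE; congr (_ * _); apply: eq_bigr => l _; rewrite !mxE mulrC.
  exact: dotxx_ge0.
have gprod : \prod_i g i = (\det A) ^+ 2.
  rewrite -[LHS](det_trig (A := W *m G *m W^T)); last exact: is_diag_mx_is_trig.
  rewrite det_mulmx [\det (W *m G)]det_mulmx mulrAC -det_mulmx WW det1 mul1r.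
  by rewrite /G det_mulmx det_tr expr2.
(* Apart from the factorial, the bound for [s j] is a product over the indices i in [s j] of 2
   sqrt(d) sqrt(g_i). The cover reassembles these into 2^d sqrt(d)^d |\det A|, exactly the constant
   times the lower bound for the volume of [K]. *)
rewrite (eq_bigr (fun j => (Num.sqrt (#|s j|)`!%:R)^-1 *
    \prod_(i in s j) (2 * Num.sqrt d%:R * Num.sqrt (g i)))); last first.
  move=> j _; rewrite sqrt_prod // !big_split /= !prodr_const.
  by move: (\prod_(i in s j) _) => x; ring.
rewrite big_split /= prod_cover // prodfV !big_split /= !prodr_const card_ord.
have -> : \prod_i Num.sqrt (g i) = `|\det A| by rewrite -sqrt_prod // gprod sqrtr_sqr.
by rewrite le_eqVlt; apply/orP; left; apply/eqP; ring.
Qed.
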